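(* Let $X$ be a real-valued Lévy process with diffusion coefficient $\sigma^2$, Lévy measure $\nu$ and drift $\gamma_0$, such that $\int (1\wedge|x|)\,\nu(dx)<\infty$, $\sigma^2=0$, $\gamma_0>0$, $0\notin\mathrm{supp}(\nu|_{(-\infty,0]})$, but $\nu((-\infty,0))\neq 0$. Let $W:=-\sup\mathrm{supp}(\nu|_{(-\infty,0]})$. Let $m\in[0,\infty)$ and $a,b\in(0,\infty)$. Then one has both $\lambda_{a,b}^+([m,\infty))>0$ and $\lambda_{a,b}^-([m,\infty))>0$ if and only if $m\gamma_0<a$ or $a+b>W$.
   Context: $X=(X_t)_{t\ge 0}$ is a real-valued Lévy process (càdlàg paths, $X_0=0$ a.s., stationary independent increments) defined on a filtered probability space $(\Omega,\mathcal F,\mathbb F,\mathsf P)$ satisfying the standard assumptions, $X$ being $\mathbb F$-adapted. $\sigma^2\ge 0$ is its diffusion (Gaussian) coefficient and $\nu$ its Lévy measure (with $\nu(\{0\})=0$). When $\int(1\wedge|x|)\,\nu(dx)<\infty$, the drift $\gamma_0\in\mathbb R$ is the constant such that, by the Lévy–Itô decomposition, $X_t=\gamma_0 t+G_t+\sum_{0<s\le t}\Delta X_s$, with $G$ a driftless Gaussian Lévy process of variance $\sigma^2t$ at time $t$. For $a,b\in(0,\infty)$ ($a=b$ allowed), $T_{a,b}(X)=\inf\{t\ge 0: X_t\in\mathbb R\setminus(-b,a)\}$ (with $\inf\emptyset=\infty$) is the first exit time of $X$ from $(-b,a)$. The measures $\lambda_{a,b}^{\pm}$ on the Borel sets of $[0,\infty)$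 are defined by $\lambda_{a,b}^-(A)=\mathsf P(T_{a,b}(X)<\infty,\ X_{T_{a,b}(X)}\le -b,\ T_{a,b}(X)\in A)$ and $\lambda_{a,b}^+(A)=\mathsf P(T_{a,b}(X)<\infty,\ X_{T_{a,b}(X)}\ge a,\ T_{a,b}(X)\in A)$. $\mathrm{supp}(\rho)$ is the topological support of a measure $\rho$, and $\nu|_{(-\infty,0]}$ is the restriction of $\nu$ to $(-\infty,0]$; thus $0\notin\mathrm{supp}(\nu|_{(-\infty,0]})$ means $\nu((-\epsilon,0))=0$ for some $\epsilon>0$. *)

(* Defs.v *)
(* MathComp-Analysis, over an abstract R : realType. *)
From HB Require Import structures.
From mathcomp Require Import all_boot all_order all_algebra.
From mathcomp Require Import all_classical all_reals all_analysis.

Set Implicit Arguments.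
Unset Strict Implicit.
Unset Printing Implicit Defensive.

Import Order.TTheory GRing.Theory Num.Theory.
Import numFieldNormedType.Exports.

Local Open Scope classical_set_scope.
Local Open Scope ring_scope.

(* Time is [0, +oo[: filtrations and processes are indexed by R, but only
   their values at nonnegative times are ever used. *)

Section stochastic_basis.
Context {d : measure_display} {T : measurableType d} {R : realType}.
Variables (P : probability T R) (F : R -> set (set T)).

Definition filtration : Prop :=
  [/\ forall t : R, 0 <= t -> sigma_algebra setT (F t),
      forall t : R, 0 <= t -> F t `<=` measurable &
      forall s t : R, 0 <= s -> s <= t -> F s `<=` F t].

(* Right-continuity, and completeness: subsets of P-null sets belong to F 0,
   hence are measurable, so that P itself is complete. *)
Definition usual_conditions : Prop :=
  [/\ filtration,
      forall t : R, 0 <= t -> \bigcap_(s in [set s | t < s]) F s `<=` F t &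
      P.-negligible `<=` F 0].

Variable X : R -> T -> R.

Definition adapted : Prop :=
  forall (t : R) (B : set R), 0 <= t -> measurable B -> F t (X t @^-1` B).

Definition cadlag_paths : Prop :=
  forall w,
    (forall t : R, 0 <= t -> X r w @[r --> t^'+] --> X t w) /\
    (forall t : R, 0 < t -> cvg (X r w @[r --> t^'-])).

Definition stationary_increments : Prop :=
  forall (s t h : R) (B : set R), 0 <= s -> 0 <= t -> 0 <= h -> measurable B ->
    P [set w | B (X (s + h) w - X s w)] = P [set w | B (X (t + h) w - X t w)].

(* The product rule on subfamilies is the case where some B i are setT. *)
Definition independent_increments : Prop :=
  forall (n : nat) (t : nat -> R) (B : nat -> set R),
    0 <= t 0%N -> (forall i, t i <= t i.+1) -> (forall i, measurable (B i)) ->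
    P (\bigcap_(i in [set i | (i < n)%N])
         [set w | B i (X (t i.+1) w - X (t i) w)]) =
    (\prod_(i < n) P [set w | B i (X (t i.+1) w - X (t i) w)%R])%E.

Definition levy_process : Prop :=
  [/\ adapted,
      cadlag_paths,
      {ae P, forall w, X 0 w = 0},
      stationary_increments &
      independent_increments].

End stochastic_basis.

(* The centred Gaussian law of variance v on R; the degenerate case is separate
   because normal_prob m 0 is not the Dirac mass at m. *)
Definition centred_gaussian {R : realType} (v : R) (B : set R) : \bar R :=
  if v == 0 then \d_(0 : R) B else normal_prob 0 (Num.sqrt v) B.

Section levy_characteristics.
Context {d : measure_display} {T : measurableType d} {R : realType}.
Variables (P : probability T R) (F : R -> set (set T)) (X : R -> T -> R).

(* For t > 0. *)
Definition jump (w : T) (t : R) : R := X t w - lim (X r w @[r --> t^'-]).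

Definition jump_times (A : set R) (w : T) : set R :=
  [set s : R | [/\ 0 < s, s <= 1, jump w s != 0 & A (jump w s)]].

(* The Lévy measure of a Borel set A is the expected number, per unit of time,
   of jumps whose size is in A. *)
Definition is_levy_measure (nu : {measure set R -> \bar R}) : Prop :=
  forall A : set R, measurable A ->
    nu A = (\int[P]_w counting (jump_times A w))%E.

(* The sum of the jumps over ]0, t], as positive part minus negative part; it
   is a real number iff the jumps are absolutely summable, because
   +oo - +oo = -oo in \bar R. *)
Definition jump_sum (w : T) (t : R) : \bar R :=
  (\esum_(s in [set s : R | 0 < s <= t]%R) (Num.max (jump w s) 0)%R%:E -
   \esum_(s in [set s : R | 0 < s <= t]%R) (Num.max (- jump w s) 0)%R%:E)%E.

Definition driftless_gaussian_levy (sigma2 : R) (G : R -> T -> R) : Prop :=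
  levy_process P F G /\
  forall (t : R) (B : set R), 0 <= t -> measurable B ->
    P (G t @^-1` B) = centred_gaussian (sigma2 * t) B.

(* The Lévy-Itô decomposition of a process whose jumps are absolutely summable;
   it determines both the diffusion coefficient sigma2 and the drift gamma0. *)
Definition diffusion_and_drift (sigma2 gamma0 : R) : Prop :=
  0 <= sigma2 /\
  exists G : R -> T -> R,
    driftless_gaussian_levy sigma2 G /\
    {ae P, forall w, forall t : R, 0 <= t ->
      (X t w)%:E = ((gamma0 * t)%R%:E + (G t w)%:E + jump_sum w t)%E}.

End levy_characteristics.

Section two_sided_exit.
Context {d : measure_display} {T : measurableType d} {R : realType}.
Variables (P : probability T R) (X : R -> T -> R) (a b : R).

Definition exit_time (w : T) : \bar R :=
  ereal_inf [set t%:E | t in [set t : R | 0 <= t /\ ~ (- b < X t w < a)]].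

Definition lambda_minus (A : set R) : \bar R :=
  P [set w | [/\ (exit_time w < +oo)%E, X (fine (exit_time w)) w <= - b &
                 A (fine (exit_time w))]].

Definition lambda_plus (A : set R) : \bar R :=
  P [set w | [/\ (exit_time w < +oo)%E, a <= X (fine (exit_time w)) w &
                 A (fine (exit_time w))]].

End two_sided_exit.

Definition measure_support {R : realType} (rho : set R -> \bar R) : set R :=
  [set x | forall U : set R, open U -> U x -> (0 < rho U)%E].

(* The restriction of nu to ]-oo, 0], as a measure on R. *)
Definition restr_npos {R : realType} (nu : {measure set R -> \bar R}) :
    set R -> \bar R :=
  mrestr nu (measurable_itv `]-oo, (0 : R)]).

(* Main.v *)
(* Off a null set the path is the drift plus its jumps, and every negative jump is
   at most - W. Two events have positive probability on every interval of time:
   staying close to the drift, and, on some short interval, making a single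
   downward step of size close to W. By independence of the increments these
   moves can be chained. If a + b > W, one alternates climbing to a level c of
   ]W - b, a[ and jumping down by W, which keeps the path inside ]-b, a[ for as
   long as desired; if m * gamma0 < a, following the drift up to time m is enough.
   From there a further climb, or enough downward steps, realises either exit.
   Conversely, if m * gamma0 >= a and a + b <= W, the first negative jump made
   before reaching a is an exit from below; as the path lies above the drift until
   then, this exit takes place before time m almost surely. *)
Require Import Defs.
From HB Require Import structures.
From mathcomp Require Import all_boot all_order all_algebra.
From mathcomp Require Import all_classical all_reals all_analysis.
From mathcomp Require Import measurable_realfun.
From mathcomp Require Import ring lra.

Set Implicit Arguments.
Unset Strict Implicit.
Unset Printing Implicit Defensive.

Import Order.TTheory GRing.Theory Num.Theory.
Import numFieldNormedType.Exports.

Local Open Scope classical_set_scope.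
Local Open Scope ring_scope.

(** The product rule for increments speaks of finitely many times, whereas staying in an interval
    constrains all of them. Chaining therefore rests on two devices: [tube] events, which constrain
    the path relative to its position at a time [s] and, by right-continuity, are decreasing limits
    of dyadic events; and [past s C], the independence of [C] from later increments, which
    intersecting with a tube preserves. The positivity of tubes is obtained by contradiction, from
    countable covers by null events. The Lévy measure is an expected count of jumps in ]0, 1], and
    this count is not known to be measurable; increments over fine meshes are what stationarity can
    carry to other times. Likewise the exit events must be shown measurable: for paths with isolated
    negative jumps, survival can be read at countably many times, and completeness absorbs the other
    paths. *)

(** * Extension of a product rule from a pi-system *)

Section dynkin_product.
Context d (T : measurableType d) (R : realType) (P : probability T R).

(** Pi-lambda argument with two maps at once: with [f] and [g] the increments from two starting
    times, it yields independence from [C] and equality in law together. Measurability travels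
    along, since it is known on [G] only. *)
Lemma dynkin_product (S : Type) (G : set (set S)) (f g : T -> S)
    (C : set T) (k : R) :
  setI_closed G -> measurable C -> P C = k%:E ->
  (forall A, G A -> [/\ measurable (f @^-1` A), measurable (g @^-1` A) &
                        (P (C `&` f @^-1` A) = k%:E * P (g @^-1` A))%E]) ->
  forall A, <<s G >> A -> [/\ measurable (f @^-1` A), measurable (g @^-1` A) &
                        (P (C `&` f @^-1` A) = k%:E * P (g @^-1` A))%E].
Proof.
move=> GI mC PC H A.
have k0 : 0 <= k by rewrite -lee_fin -PC.
rewrite -setI_closed_g_dynkin_g_sigma_algebra //.
move: A; change (<<d G >> `<=` [set A | [/\ measurable (f @^-1` A),
  measurable (g @^-1` A) & (P (C `&` f @^-1` A) = k%:E * P (g @^-1` A))%E]]).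
apply: smallest_sub; last exact: H.
split.
- split; [exact: measurableT|exact: measurableT|].
  by rewrite /= !preimage_setT setIT PC probability_setT mule1.
- move=> B [mf mg E]; split; [exact: measurableC|exact: measurableC|].
  rewrite (_ : f @^-1` (~` B) = ~` (f @^-1` B))// (_ : g @^-1` (~` B) = ~` (g @^-1` B))//.
  rewrite probability_setC// -setDE measureD; [|by []|by []|].
    transitivity (k%:E - k%:E * P (g @^-1` B))%E; first by rewrite -E -PC.
    have /fineK <- : P (g @^-1` B) \is a fin_num by exact: fin_num_measure.
    by rewrite -EFinM -(EFinB k) -(EFinB 1) -EFinM mulrBr mulr1.
  by change (P C < +oo)%E; rewrite PC ltry.
- move=> F tF H'.
  have tFp h : trivIset setT (fun i => h @^-1` F i : set T).
    apply/trivIsetP => i j _ _ ij; rewrite -preimage_setI.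
    by move/trivIsetP : tF => ->//; rewrite preimage_set0.
  split.
  + by rewrite preimage_bigcup; apply: bigcup_measurable => i _; case: (H' i).
  + by rewrite preimage_bigcup; apply: bigcup_measurable => i _; case: (H' i).
  + rewrite !preimage_bigcup setI_bigcupr !measure_bigcup//=.
    * rewrite -nneseriesZl//.
      by apply: eq_eseriesr => i _; case: (H' i).
    * by move=> i _; case: (H' i).
    * by move=> i _; apply: measurableI => //; case: (H' i).
    * by apply: trivIset_setIl; exact: tFp.
Qed.

End dynkin_product.

(** * Positions of a path as functions of its increments *)

Section cumulative.
Context (R : realType).

Definition boxes (n : nat) : set (set (nat -> R)) :=
  [set A | exists2 B : nat -> set R, (forall i, measurable (B i)) &
     A = [set f : nat -> R | forall i, (i < n)%N -> B i (f i)]].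

Lemma boxes_setI_closed n : setI_closed (boxes n).
Proof.
move=> _ _ [B mB ->] [D mD ->]; exists (fun i => B i `&` D i).
  by move=> i; exact: measurableI.
apply/seteqP; split => f /=.
- by move=> [H1 H2] i ni; split; [exact: H1|exact: H2].
- by move=> H; split => i ni; case: (H i ni).
Qed.

(** With [f] the successive increments of a path, the sums are its positions relative to the start:
    constraints on these are events on [n] increments. *)
Lemma cumulative_boxes n (D : nat -> set R) : (forall j, measurable (D j)) ->
  <<s boxes n >> [set f : nat -> R |
     forall j, (j <= n)%N -> D j (\sum_(0 <= i < j) f i)].
Proof.
move=> mD.
have mcoord i : (i < n)%N ->
    measurable_fun setT (fun f : g_sigma_algebraType (boxes n) => f i).
  move=> ni _ B mB; rewrite setTI; apply: sub_sigma_algebra.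
  exists (fun j => if j == i then B else setT).
    by move=> j; case: ifP.
  apply/seteqP; split => f /=.
    by move=> Bf j _; case: eqP => // ->.
  by move=> /(_ i ni); rewrite eqxx.
have msum j : (j <= n)%N -> measurable_fun setT
    (fun f : g_sigma_algebraType (boxes n) => \sum_(0 <= i < j) f i).
  elim: j => [|j IH] jn.
    rewrite (_ : (fun _ => _) = cst (0 : R)); first exact: measurable_cst.
    by apply/funext => f; rewrite big_nil.
  rewrite (_ : (fun _ => _) = (fun f : g_sigma_algebraType (boxes n) =>
      \sum_(0 <= i < j) f i + f j)); last first.
    by apply/funext => f; rewrite big_nat_recr.
  by apply: measurable_funD; [exact: IH (ltnW jn)|exact: mcoord].
rewrite (_ : [set _ | _] = \bigcap_(j in [set j | (j <= n)%N])
  ((fun f : g_sigma_algebraType (boxes n) => \sum_(0 <= i < j) f i) @^-1` D j)).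
  apply: (@bigcap_measurableType _ (g_sigma_algebraType (boxes n))) => j /= jn.
  by rewrite -[X in measurable X]setTI; exact: msum.
by apply/seteqP; split.
Qed.

End cumulative.

(** * Independence of the past and tubes of paths *)

Section levy.
Context d (T : measurableType d) (R : realType) (P : probability T R).
Variable X : R -> T -> R.
Hypothesis mX : forall t, 0 <= t -> measurable_fun setT (X t).
Hypothesis cadlagX : cadlag_paths X.
Hypothesis staX : stationary_increments P X.
Hypothesis indX : independent_increments P X.
Implicit Types (s h e : R) (w : T) (C : set T).

Lemma cadlag_right w t e : 0 <= t -> 0 < e ->
  exists2 e', 0 < e' & forall r, t <= r < t + e' -> `|X r w - X t w| < e.
Proof.
move=> t0 e0; have [/(_ t t0) /cvgrPdist_lt/(_ e e0) + _] := cadlagX w.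
move=> [e' /= e'0 H]; exists e' => // r /andP[].
rewrite le_eqVlt => /predU1P[<- _|tr rt]; first by rewrite subrr normr0.
rewrite distrC; apply: H => //=.
by rewrite distrC ger0_norm ?subr_ge0 ?(ltW tr)// ltrBlDl.
Qed.

Lemma cadlag_left w t e : 0 < t -> 0 < e ->
  exists2 e', 0 < e' & forall r, t - e' < r < t ->
    `|X r w - lim (X r w @[r --> t^'-])| < e.
Proof.
move=> t0 e0; have [_ /(_ t t0) /cvgrPdist_lt/(_ e e0)] := cadlagX w.
move=> [e' /= e'0 H]; exists e' => // r /andP[tr rt].
rewrite distrC; apply: H => //=.
by rewrite ger0_norm ?subr_ge0 ?(ltW rt)//; lra.
Qed.

Definition slab (n : nat) (t : nat -> R) (B : nat -> set R) : set T :=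
  [set w | forall i, (i < n)%N -> B i (X (t i.+1) w - X (t i) w)].

Lemma measurable_inc s t : 0 <= s -> 0 <= t ->
  measurable_fun setT (fun w => X t w - X s w).
Proof. by move=> s0 t0; apply: measurable_funB; exact: mX. Qed.

Lemma measurable_incB s (t : R) B : 0 <= s -> 0 <= t -> measurable B ->
  measurable [set w | B (X t w - X s w)].
Proof.
move=> s0 t0 mB; rewrite -[X in measurable X]setTI.
exact: (measurable_inc s0 t0).
Qed.

Lemma ge0_seq (t : nat -> R) : 0 <= t 0%N -> (forall i, t i <= t i.+1) ->
  forall i, 0 <= t i.
Proof. by move=> t0 tS; elim=> // i IH; exact: le_trans (tS i). Qed.

Lemma measurable_slab n (t : nat -> R) B : 0 <= t 0%N -> (forall i, t i <= t i.+1) ->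
  (forall i, measurable (B i)) -> measurable (slab n t B).
Proof.
move=> t0 tS mB; apply: bigcap_measurableType => i _.
by apply: measurable_incB => //; exact: ge0_seq.
Qed.

Lemma slab_prob n (t : nat -> R) B : 0 <= t 0%N -> (forall i, t i <= t i.+1) ->
  (forall i, measurable (B i)) ->
  P (slab n t B) = (\prod_(i < n) P [set w | B i (X (t i.+1) w - X (t i) w)%R])%E.
Proof. by move=> t0 tS mB; exact: indX. Qed.

(** Independence of [C] from the increments after [s], tested on slabs: the property that each move
    consumes and restores at a later time. *)
Definition past (s : R) (C : set T) : Prop :=
  measurable C /\ forall n t B, s <= t 0%N -> (forall i, t i <= t i.+1) ->
    (forall i, measurable (B i)) ->
    (P (C `&` slab n t B) = P C * P (slab n t B))%E.

Definition grid (s h : R) (i : nat) : R := s + h * i%:R.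

Lemma gridS s h : 0 <= h -> forall i, grid s h i <= grid s h i.+1.
Proof. by move=> h0 i; rewrite lerD2l ler_wpM2l// ler_nat. Qed.

Lemma grid0 s h : grid s h 0 = s.
Proof. by rewrite /grid mulr0 addr0. Qed.

Lemma slab_grid_prob s s' h n B : 0 <= s -> 0 <= s' -> 0 <= h ->
  (forall i, measurable (B i)) ->
  P (slab n (grid s h) B) = P (slab n (grid s' h) B).
Proof.
move=> s0 s'0 h0 mB.
rewrite !slab_prob ?grid0//; [|exact: gridS..].
apply: eq_bigr => i _; rewrite /grid -addn1 natrD mulrDr mulr1 !addrA.
have hi : 0 <= h * i%:R by rewrite mulr_ge0.
by apply: staX => //; exact: addr_ge0.
Qed.

Lemma slab_grid_future s s' h N C n (t : nat -> R) B B' : 0 <= s -> 0 <= s' -> 0 <= h ->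
  past s C -> s + h * N%:R <= t 0%N -> (forall i, t i <= t i.+1) ->
  (forall i, measurable (B i)) -> (forall i, measurable (B' i)) ->
  (P ((C `&` slab n t B') `&` slab N (grid s h) B) =
   (P C * P (slab n t B')) * P (slab N (grid s' h) B))%E.
Proof.
move=> s0 s'0 h0 [mC pC] Nt tS mB mB'.
(* Grid times followed by [t]: step [N] joins the last grid time to [t 0], and its constraint [setT]
   has probability 1. *)
pose tc i := if (i <= N)%N then grid s h i else t (i - N.+1)%N.
pose Bc i := if (i < N)%N then B i else if i == N then setT else B' (i - N.+1)%N.
have tcS i : tc i <= tc i.+1.
  rewrite /tc; case: (ltnP i N) => iN; first by rewrite (ltnW iN) gridS.
  case: (ltngtP i N) iN => // [Ni|->] _; first by rewrite subSn.
  by rewrite subnn.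
have mBc i : measurable (Bc i) by rewrite /Bc; do 2 case: ifP => // _.
have tc0 : tc 0%N = s by rewrite /tc leq0n grid0.
have t0 : 0 <= t 0%N by rewrite (le_trans _ Nt)// addr_ge0// mulr_ge0.
have tcN i : tc (N.+1 + i)%N = t i.
  by rewrite /tc leqNgt addSn ltnS leq_addr /= subSS addKn.
have BcN i : Bc (N.+1 + i)%N = B' i.
  by rewrite /Bc ltnNge addSn ltnW ?ltnS ?leq_addr//= gtn_eqF ?ltnS ?leq_addr// subSS addKn.
have -> : (C `&` slab n t B') `&` slab N (grid s h) B = C `&` slab (N.+1 + n) tc Bc.
  rewrite -setIA; congr (_ `&` _); apply/seteqP; split => w /=.
  - move=> [H1 H2] i iNn; case: (ltngtP i N) => [iN|Ni|->].
    + by move: (H2 i iN); rewrite /tc /Bc iN (ltnW iN).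
    + have := H1 (i - N.+1)%N; rewrite -BcN -!tcN subnKC// addnS subnKC//; apply.
      by rewrite ltn_subLR.
    + by rewrite /Bc ltnn eqxx.
  - move=> H; split=> i ni.
    + by have := H (N.+1 + i)%N; rewrite BcN -addnS !tcN; apply; rewrite leq_add2l.
    + have := H i; rewrite /tc /Bc ni (ltnW ni); apply.
      by rewrite (leq_trans ni)// addSn ltnW// ltnS leq_addr.
rewrite pC//; last by rewrite tc0.
rewrite -muleA; congr (_ * _)%E.
rewrite slab_prob//; last by rewrite tc0.
rewrite big_split_ord/= big_ord_recr/=.
have -> : P [set w | Bc N (X (tc N.+1) w - X (tc N) w)] = 1%E.
  by rewrite /Bc ltnn eqxx probability_setT.
rewrite mule1 muleC (slab_grid_prob (s := s') (s' := s))// !slab_prob//; [|by rewrite grid0|exact: gridS].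
congr (_ * _)%E; apply: eq_bigr => i _.
  by rewrite BcN -addnS !tcN.
by rewrite /tc /Bc ltn_ord (ltnW (ltn_ord i)).
Qed.


Definition tube (s h : R) (D : R -> set R) : set T :=
  [set w | forall u, 0 <= u <= h -> D u (X (s + u) w - X s w)].

Definition dyadic_tube (s h : R) (D : R -> set R) (n : nat) : set T :=
  [set w | forall j, (j <= 2 ^ n)%N ->
     D (h / (2 ^ n)%:R * j%:R) (X (s + h / (2 ^ n)%:R * j%:R) w - X s w)].

(* The complement is open for the product of the topology of ]-oo, +oo[ and of
   the right topology of time: a right-continuous path then lies in D as soon
   as it does so at dyadic times. *)
Definition right_closed (h : R) (D : R -> set R) : Prop :=
  (forall u, measurable (D u)) /\
  forall u x, 0 <= u < h -> ~ D u x -> exists2 e, 0 < e &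
    forall v y, u <= v < u + e -> `|y - x| < e -> ~ D v y.

(** Dyadic positions are partial sums of grid increments, so [dynkin_product] extends the rule from
    boxes to tubes. The slab stands for the future; keeping it here lets [past] be recovered in the
    limit. *)
Lemma dyadic_tube_prob s s' h C (D : R -> set R) n m (t : nat -> R) B : 0 <= s -> 0 <= s' -> 0 <= h ->
  past s C -> s + h <= t 0%N -> (forall i, t i <= t i.+1) ->
  (forall u, measurable (D u)) -> (forall i, measurable (B i)) ->
  measurable (dyadic_tube s h D n) /\
  (P ((C `&` slab m t B) `&` dyadic_tube s h D n) =
   (P C * P (slab m t B)) * P (dyadic_tube s' h D n))%E.
Proof.
move=> s0 s'0 h0 pC ht tS mD mB.
set N := (2 ^ n)%N; set q := h / N%:R.
have N0 : (N%:R : R) != 0 by rewrite pnatr_eq0 expn_eq0.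
have q0 : 0 <= q by rewrite divr_ge0.
have qN : q * N%:R = h by rewrite divfK.
pose xi (r : R) (w : T) (i : nat) := X (grid r q i.+1) w - X (grid r q i) w.
pose A := [set f : nat -> R | forall j, (j <= N)%N ->
   D (q * j%:R) (\sum_(0 <= i < j) f i)].
have tubeA r : dyadic_tube r h D n = xi r @^-1` A.
  apply/seteqP; split => w /= H j jN; move: (H j jN);
    by rewrite (telescope_sumr (fun i => X (grid r q i) w))// grid0.
have t0 : 0 <= t 0%N by rewrite (le_trans _ ht)// addr_ge0.
have mF : measurable (slab m t B) by exact: measurable_slab.
have [mC _] := pC.
have mCF : measurable (C `&` slab m t B) by exact: measurableI.
have PCF : P (C `&` slab m t B) = (P C * P (slab m t B))%E.
  by case: pC => _ ->//; rewrite (le_trans _ ht)// lerDl.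
have fk : P (C `&` slab m t B) \is a fin_num by exact: fin_num_measure.
rewrite !tubeA -PCF -(fineK fk).
have [|||||mf _ E] := @dynkin_product _ _ _ P _ (@boxes R N) (xi s) (xi s')
  (C `&` slab m t B) (fine (P (C `&` slab m t B))) _ _ _ _ A _.
- exact: boxes_setI_closed.
- exact: mCF.
- by rewrite fineK.
- move=> _ [B' mB' ->]; rewrite fineK//; split.
  + by apply: (@measurable_slab N (grid s q)); rewrite ?grid0//; exact: gridS.
  + by apply: (@measurable_slab N (grid s' q)); rewrite ?grid0//; exact: gridS.
  + rewrite PCF; apply: slab_grid_future => //.
    by rewrite qN.
- exact: (@cumulative_boxes _ N (fun j => D (q * j%:R))).
- by split.
Qed.

(** If [D] fails at some [u < h], it fails for all nearby positions at times just after [u], and one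
    of these times is dyadic. *)
Lemma tubeE s h D : 0 <= s -> 0 < h -> right_closed h D ->
  tube s h D = \bigcap_n dyadic_tube s h D n.
Proof.
move=> s0 h0 [_ rD]; apply/seteqP; split => [w H n _ j jn|w H u].
  have n0 : (0 : R) < (2 ^ n)%:R by rewrite ltr0n expn_gt0.
  apply: H; rewrite mulr_ge0 ?divr_ge0 ?(ltW h0)//=.
  by rewrite -mulrA ler_piMr ?(ltW h0)// mulrC ler_pdivrMr// mul1r ler_nat.
move=> /andP[u0]; rewrite le_eqVlt => /predU1P[->|uh].
  (* The end time [h], at which [right_closed] asks for no openness, is a dyadic time of level 0. *)
  by have := H 0%N I 1%N; rewrite expn0 divr1 mulr1; exact.
apply: contrapT => /(rD u _ _)[|e e0 K]; first by rewrite u0.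
have [e' e'0 K'] := cadlag_right w (addr_ge0 s0 u0) e0.
pose e1 := Num.min (Num.min e e') (h - u).
have e10 : 0 < e1 by rewrite !lt_min e0 e'0 subr_gt0.
have [n hn] : exists n, h / (2 ^ n)%:R < e1.
  exists (Num.truncn (h / e1)).+1.
  have n0 : (0 : R) < (2 ^ (Num.truncn (h / e1)).+1)%:R by rewrite ltr0n expn_gt0.
  rewrite ltr_pdivrMr// mulrC -ltr_pdivrMr//.
  apply: lt_trans (truncnS_gt _) _.
  by rewrite ltr_nat ltn_expl.
set N := (2 ^ n)%:R in hn *.
have N0 : 0 < N by rewrite ltr0n expn_gt0.
have uE : u = h / N * (u * N / h) by field; rewrite !gt_eqF.
pose j := (Num.truncn (u * N / h)).+1.
have uj : u < h / N * j%:R.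
  by rewrite {1}uE ltr_pM2l ?divr_gt0// truncnS_gt.
have uj' : h / N * j%:R <= u + h / N.
  rewrite -natr1 mulrDr mulr1 lerD2r [leRHS]uE ler_pM2l ?divr_gt0//.
  have : 0 <= u * N / h by rewrite divr_ge0 ?(ltW h0)// mulr_ge0// ltW.
  by move=> /truncn_itv/andP[].
move: hn; rewrite !lt_min => /andP[/andP[hne hne'] hnu].
have jN : (j <= 2 ^ n)%N.
  rewrite -(ler_nat R) -/N -(ler_pM2l (divr_gt0 h0 N0)) divfK ?gt_eqF//; lra.
apply: (K (h / N * j%:R) (X (s + h / N * j%:R) w - X s w)).
- by apply/andP; split; lra.
- rewrite opprB addrA subrK; apply: K'; apply/andP; split; lra.
- exact: (H n).
Qed.

Lemma dyadic_tube_decr s h D n : dyadic_tube s h D n.+1 `<=` dyadic_tube s h D n.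
Proof.
move=> w H j jn; have := H (2 * j)%N; rewrite expnS leq_mul2l jn orbT => /(_ isT).
have N0 : (2 ^ n)%:R != 0 :> R by rewrite pnatr_eq0 expn_eq0.
suff -> : h / (2 * 2 ^ n)%:R * (2 * j)%:R = h / (2 ^ n)%:R * j%:R :> R by [].
by rewrite !natrM; field.
Qed.


Lemma right_closed_measurable h D u : right_closed h D -> measurable (D u).
Proof. by case. Qed.

Lemma pastT s : 0 <= s -> past s setT.
Proof.
by move=> s0; split=> // n t B ht tS mB; rewrite setTI probability_setT mul1e.
Qed.

(** Limit of the dyadic identities along a decreasing sequence. It serves as a Markov property: the
    tube is independent of [C], may be restarted at any [s'], and leaves an event independent of
    what follows [s + h]. *)
Lemma tube_past s s' h C D : 0 <= s -> 0 <= s' -> 0 < h -> right_closed h D ->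
  past s C -> past (s + h) (C `&` tube s h D) /\
  (P (C `&` tube s h D) = P C * P (tube s' h D))%E.
Proof.
move=> s0 s'0 h0 rD pC; have [mC _] := pC.
have mD u := right_closed_measurable u rD.
have mdt r n : 0 <= r -> measurable (dyadic_tube r h D n).
  move=> r0.
  by have [] // := @dyadic_tube_prob r r h setT D n 0 (fun=> r + h) (fun=> setT)
    r0 r0 (ltW h0) (pastT r0).
have mt r : 0 <= r -> measurable (tube r h D).
  by move=> r0; rewrite tubeE//; apply: bigcapT_measurable => n; exact: mdt.
have lim_tube r E : 0 <= r -> measurable E ->
    P (E `&` dyadic_tube r h D n) @[n --> \oo] --> P (E `&` tube r h D).
  move=> r0 mE; rewrite tubeE//.
    have -> : E `&` \bigcap_n dyadic_tube r h D n = \bigcap_n (E `&` dyadic_tube r h D n).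
      apply/seteqP; split => [w [Ew H] n _|w H]; first by split => //; exact: H.
      by split=> [|n _]; [have [] := H 0%N I|have [] := H n I].
  apply: nonincreasing_cvg_mu.
  - by rewrite -ge0_fin_numE// fin_num_measure//; apply: measurableI => //; exact: mdt.
  - by move=> n; apply: measurableI => //; exact: mdt.
  - by apply: bigcapT_measurable => n; apply: measurableI => //; exact: mdt.
  - apply/nonincreasing_seqP => n; apply/subsetPset.
    by apply: setIS; exact: dyadic_tube_decr.
have key m t B : s + h <= t 0%N -> (forall i, t i <= t i.+1) ->
    (forall i, measurable (B i)) ->
    (P ((C `&` tube s h D) `&` slab m t B) =
      P C * P (slab m t B) * P (tube s' h D))%E.
  move=> ht tS mB.
  have mF : measurable (slab m t B).
    by apply: measurable_slab => //; rewrite (le_trans _ ht)// addr_ge0// ltW.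
  have := lim_tube s _ s0 (measurableI _ _ mC mF).
  rewrite (eq_cvg _ _ (fun n => proj2 (@dyadic_tube_prob s s' h C D n m t B
    s0 s'0 (ltW h0) pC ht tS mD mB))).
  rewrite -setIA (setIC (slab m t B)) setIA => /cvg_unique; apply => //.
  apply: cvgeZl; first by rewrite fin_numM// fin_num_measure.
  have := lim_tube s' _ s'0 measurableT.
  by rewrite setTI; under eq_cvg do rewrite setTI.
have E : (P (C `&` tube s h D) = P C * P (tube s' h D))%E.
  have := key 0%N (fun=> s + h) (fun=> setT) (lexx _) (fun=> lexx _) (fun=> measurableT).
  by rewrite (_ : slab _ _ _ = setT) ?setIT ?probability_setT ?mule1//; apply/seteqP; split.
split => //; split; first by apply: measurableI => //; exact: mt.
by move=> m t B ht tS mB; rewrite key// E muleAC.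
Qed.

Lemma measurable_tube s h D : 0 <= s -> 0 < h -> right_closed h D ->
  measurable (tube s h D).
Proof.
by move=> s0 h0 rD; have [[]] := tube_past s0 s0 h0 rD (pastT s0); rewrite setTI.
Qed.

Lemma tube_prob s s' h D : 0 <= s -> 0 <= s' -> 0 < h -> right_closed h D ->
  P (tube s h D) = P (tube s' h D).
Proof.
move=> s0 s'0 h0 rD; have [_] := tube_past s0 s'0 h0 rD (pastT s0).
by rewrite setTI probability_setT mul1e.
Qed.

Lemma tube_iter h D n : 0 < h -> right_closed h D ->
  past (h * n%:R) [set w | forall i, (i < n)%N -> tube (h * i%:R) h D w] /\
  (P [set w | forall i, (i < n)%N -> tube (h * i%:R) h D w] =
    P (tube 0 h D) ^+ n)%E.
Proof.
move=> h0 rD; elim: n => [|n [pn IH]].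
  rewrite (_ : [set _ | _] = setT); last by apply/seteqP; split.
  by rewrite probability_setT; split => //; apply: pastT; rewrite mulr0.
have hn0 : 0 <= h * n%:R by rewrite mulr_ge0// ltW.
have [] := tube_past hn0 (lexx 0) h0 rD pn.
rewrite -{1}[h in _ + h]mulr1 -mulrDr natr1 IH.
rewrite (_ : _ `&` _ = [set w | forall i, (i < n.+1)%N -> tube (h * i%:R) h D w]).
  by move=> pS E; split => //; rewrite E expeS muleC.
apply/seteqP; split => w /=.
  move=> [H1 H2] i; rewrite ltnS leq_eqVlt => /predU1P[->//|]; exact: H1.
by move=> H; split=> [i iN|]; apply: H => //; exact: ltnW.
Qed.

End levy.

(** * Cluster points and meshes of the half-line *)

Section real_sequences.
Context (R : realType).
Implicit Types (a b e t : R) (x : nat -> R).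

Lemma cluster_seq x a b : (forall n, a <= x n <= b) ->
  exists2 t, a <= t <= b &
    forall e N, 0 < e -> exists2 n, (N <= n)%N & `|x n - t| < e.
Proof.
move=> xab.
have [|t] := @segment_compact R a b (x @ \oo) _.
  by exists 0%N => // n _ /=; rewrite in_itv /= xab.
rewrite /= in_itv/= => -[abt clt]; exists t => // e N e0.
have [|_ [[n Nn <-]]] := clt (x @` [set n | (N <= n)%N]) (ball t e) _ (nbhsx_ballx t e e0).
  by exists N => // n Nn; exists n.
by rewrite /ball/= distrC => nt; exists n.
Qed.

Lemma rational_right t e : 0 <= t -> 0 < e ->
  exists n k : nat, t < k%:R / n.+1%:R < t + e.
Proof.
move=> t0 e0; pose n := Num.truncn e^-1; exists n.
have n0 : 0 < n.+1%:R :> R by rewrite ltr0n.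
exists (Num.truncn (t * n.+1%:R)).+1.
have /truncn_itv/andP[h1 h2] : 0 <= t * n.+1%:R by rewrite mulr_ge0// ltW.
rewrite ltr_pdivlMr// h2 ltr_pdivrMr//=.
have : 1 < e * n.+1%:R.
  by rewrite mulrC -ltr_pdivrMr// div1r truncnS_gt.
by rewrite -[X in _ -> X < _]natr1 mulrDl; lra.
Qed.

Lemma mesh_lt e : 0 < e -> exists n : nat, n.+1%:R^-1 < e.
Proof.
move=> e0; exists (Num.truncn e^-1).
by rewrite invf_plt ?posrE ?ltr0n// truncnS_gt.
Qed.

Lemma mesh_cell n t : 0 < t -> exists k : nat,
  k%:R / n.+1%:R < t <= k.+1%:R / n.+1%:R.
Proof.
move=> t0; have n0 : 0 < n.+1%:R :> R by rewrite ltr0n.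
have tn0 : 0 < t * n.+1%:R by rewrite mulr_gt0.
have /truncn_itv/andP[h1 h2] := ltW tn0.
set k := Num.truncn _ in h1 h2.
move: h1; rewrite le_eqVlt => /predU1P[h1|h1].
  exists k.-1; have k0 : (0 < k)%N by rewrite -(ltr_nat R) h1.
  by rewrite prednK// ltr_pdivrMr// ler_pdivlMr// -h1 lexx ltr_nat prednK// leqnn.
by exists k; rewrite ltr_pdivrMr// ler_pdivlMr// h1 ltW.
Qed.

End real_sequences.

(** * Null events and expected counts *)

Section negligible_lemmas.
Import HBNNSimple.
Context d (T : measurableType d) (R : realType) (P : probability T R).

(** [P (liminf A) <= liminf P (A n) = liminf P (B n) <= P (limsup B)]. Comparing probabilities term
    by term suits events that are time shifts of each other. *)
Lemma liminf_negligible (A B : (set T)^nat) :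
  (forall n, measurable (A n)) -> (forall n, measurable (B n)) ->
  (forall n, P (A n) = P (B n)) -> P.-negligible (lim_sup_set B) ->
  P.-negligible (\bigcup_n \bigcap_(k in [set k | (n <= k)%N]) A k).
Proof.
move=> mA mB AB NB.
have mBn n : measurable (\bigcup_(k in [set k | (n <= k)%N]) B k).
  by apply: bigcup_measurable => k _; exact: mB.
have mLB : measurable (lim_sup_set B) by apply: bigcapT_measurable.
have PB0 : P (lim_sup_set B) = 0%E by apply: measure_negligible.
have cvB : P (\bigcup_(k in [set k | (n <= k)%N]) B k) @[n --> \oo] --> (0 : \bar R)%E.
  rewrite -PB0; apply: lim_sup_set_cvg => //.
  by rewrite -ge0_fin_numE// fin_num_measure.
apply: negligible_bigcup => n.
have mAn : measurable (\bigcap_(k in [set k | (n <= k)%N]) A k).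
  by apply: bigcap_measurableType => k _; exact: mA.
apply/negligibleP => //; apply/eqP; rewrite eq_le measure_ge0 andbT.
rewrite -(cvg_lim _ cvB)//; apply: lime_ge; first by apply/cvg_ex; exists 0%E.
exists n => // k /= nk.
apply: (@le_trans _ _ (P (A k))).
  by apply: le_measure; rewrite ?inE//; exact: bigcap_inf.
rewrite AB; apply: le_measure; rewrite ?inE//.
by apply: bigcup_sup => /=.
Qed.

Lemma counting_ge1 (S : choiceType) (A : set S) : A !=set0 ->
  (1 <= counting A :> \bar R)%E.
Proof.
move=> A0; rewrite /counting; case: asboolP => [fA|_]; last exact: leey.
rewrite lee_fin ler1n finmap.cardfs_gt0; apply/finmap.fset0Pn.
by have [x Ax] := A0; exists x; rewrite in_fset_set// inE.
Qed.

Lemma counting_ge0 (S : choiceType) (A : set S) : (0 <= counting A :> \bar R)%E.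
Proof. by rewrite /counting; case: asboolP => // _; exact: leey. Qed.

(* Integrals of nonmeasurable functions are lower integrals, so no measurability
   of the counting function is required. *)
Lemma integral_counting_null (S : choiceType) (J : T -> set S) (D : set T) :
  measurable D -> (forall w, D w -> J w !=set0) ->
  (\int[P]_w counting (J w) = 0 :> \bar R)%E -> P D = 0%E.
Proof.
move=> mD DJ I0; apply/eqP; rewrite eq_le measure_ge0 andbT -I0.
rewrite ge0_integralTE//; last by move=> w; exact: counting_ge0.
apply: ereal_sup_ubound; exists (indic_nnsfun R mD); last first.
  by rewrite sintegral_indic// setIT.
move=> w; change ((\1_D w : R)%:E <= counting (J w))%E.
rewrite indicE; case: (boolP (w \in D)) => [/[!inE] wD|_] /=.
  exact/counting_ge1/DJ.
exact: counting_ge0.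
Qed.

(** A positive lower integral provides a simple function below the count; its positivity set is a
    measurable witness, even if the event that [J] is nonempty is not measurable. *)
Lemma integral_counting_pos (S : choiceType) (J : T -> set S) :
  (0 < \int[P]_w counting (J w) :> \bar R)%E ->
  exists D, [/\ measurable D, (0 < P D)%E & forall w, D w -> J w !=set0].
Proof.
rewrite ge0_integralTE; last by move=> w; exact: counting_ge0.
move=> /ereal_sup_gt[_ [h /= hJ <-] h0].
have mh : measurable (h @^-1` `]0, +oo[).
  by rewrite -[X in measurable X]setTI; exact: measurable_funP.
exists (h @^-1` `]0, +oo[); split => //.
- rewrite lt_neqAle measure_ge0 andbT eq_sym; apply/eqP => P0.
  move: h0; rewrite lt_neqAle => /andP[/eqP + _]; apply; apply/esym.
  rewrite /sintegral fsbig1// => x _.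
  have [->|x0] := eqVneq x 0; first by rewrite mul0e.
  rewrite (_ : P _ = 0%E) ?mule0//; apply/eqP; rewrite -measure_le0 -P0.
  apply: le_measure; rewrite ?inE//.
  by move=> w /= hx; rewrite in_itv/= andbT lt_neqAle hx eq_sym x0 -hx fun_ge0.
- move=> w /=; rewrite in_itv/= andbT => hw; apply/set0P/eqP => J0.
  by have := hJ w; rewrite J0 /counting asboolT// fset_set0 finmap.cardfs0 lee_fin leNgt hw.
Qed.

End negligible_lemmas.

(** * Sums over intervals of time *)

Section esum_intervals.
Context (R : realType).
Implicit Types (f : R -> \bar R) (s t u : R).

Lemma esum_itv_cat f s t u : (forall x, 0 <= f x)%E -> s <= t <= u ->
  (\esum_(r in [set r | (s < r <= u)%R]) f r =
   \esum_(r in [set r | (s < r <= t)%R]) f r +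
   \esum_(r in [set r | (t < r <= u)%R]) f r)%E.
Proof.
move=> f0 /andP[st tu]; rewrite (esumID [set r | r <= t])//.
congr (_ + _)%E; congr esum; apply/seteqP; split => r /=.
- by move=> [/andP[-> _] ->].
- by move=> /andP[-> rt]; rewrite rt (le_trans rt tu).
- by move=> [/andP[_ ->] /negP]; rewrite -ltNge => ->.
- by move=> /andP[tr ->]; rewrite (le_lt_trans st tr)/= leNgt tr.
Qed.

(* Most cells avoid a finite set carrying almost all of the sum. *)
Lemma esum_mesh_contra f t c : (forall x, 0 <= f x)%E -> 0 < t -> 0 < c ->
  (\esum_(r in [set r | (0 < r <= t)%R]) f r < +oo)%E ->
  (forall n i, (i < n.+1)%N -> ((c / n.+1%:R)%:E <
    \esum_(r in [set r | (t / n.+1%:R * i%:R < r <= t / n.+1%:R * i.+1%:R)%R])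
      f r)%E) -> False.
Proof.
move=> f0 t0 c0; set I := [set r | _] => Ioo H.
have Ifin : \esum_(r in I) f r \is a fin_num.
  by rewrite ge0_fin_numE// esum_ge0.
have c20 : 0 < c / 2 by rewrite divr_gt0.
have [_ [A [finA AI] <-] VA] := ub_ereal_sup_adherent c20 Ifin.
have IA : I `&` A = A by apply/seteqP; split => r; [case|move=> Ar; split => //; exact: AI].
have rest : (\esum_(r in I `&` ~` A) f r < (c / 2)%:E)%E.
  move: VA; rewrite -/(esum I f) (esumID A)// IA -esum_fset//.
  have := Ifin; rewrite (esumID A)// IA fin_numD => /andP[].
  set u := \esum_(i in A) f i; set v := \esum_(i in I `&` ~` A) f i.
  move: u v => [u| |]// [v| |]// _ _.
  by rewrite !lte_fin; lra.
pose k := size (finmap.enum_fset (fset_set A)).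
pose n := (2 * k)%N; pose q := c / n.+1%:R.
have n0 : 0 < n.+1%:R :> R by rewrite ltr0n.
have q0 : 0 < q by rewrite divr_gt0.
(* Each of the [k] points of [A] now weighs [q], so every cell sums to at least [q] and the total is
   at least [c]. Yet the total is less than [q k + c / 2], and [n = 2 k] gives [q k <= c / 2]. *)
pose g r := if r \in A then q%:E else f r.
have g0 r : (0 <= g r)%E by rewrite /g; case: ifP => // _; rewrite lee_fin ltW.
have tot : (\esum_(r in I) g r = (q * k%:R)%:E + \esum_(r in I `&` ~` A) f r)%E.
  rewrite (esumID A)// IA; congr (_ + _)%E; last first.
    by apply: eq_esum => r [_ /= nAr]; rewrite /g memNset.
  rewrite (eq_esum (b := fun=> q%:E)); last by move=> r Ar; rewrite /g mem_set.
  rewrite esum_fset//; last by move=> *; rewrite lee_fin ltW.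
  rewrite fsbig_finite//= sumEFin big_const_seq count_predT.
  by rewrite iter_addr_0 mulr_natr.
have low i : (i <= n.+1)%N -> ((q * i%:R)%:E <=
    \esum_(r in [set r | (0 < r <= t / n.+1%:R * i%:R)%R]) g r)%E.
  elim: i => [|i IH] ni; first by rewrite mulr0 esum_ge0.
  have h0 : 0 <= t / n.+1%:R by rewrite divr_ge0// ltW.
  rewrite (@esum_itv_cat g 0 (t / n.+1%:R * i%:R)); last 2 first.
  - by [].
  - by rewrite mulr_ge0//= ler_wpM2l// ler_nat.
  rewrite -natr1 mulrDr mulr1 EFinD; apply: leeD; first exact/IH/ltnW.
  rewrite natr1.
  set J := [set r | _].
  have [[a [Ja Aa]]|JA] := pselect (exists a, J a /\ A a).
    apply: (@le_trans _ _ (\esum_(r in [set a]) g r)).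
      by rewrite esum_set1// /g mem_set.
    apply: le_ereal_sup => _ [B [fB Ba] <-]; exists B => //; split => //.
    by move=> r /Ba ->.
  rewrite (eq_esum (b := f)); first exact/ltW/H.
  by move=> r Jr; rewrite /g memNset// => Ar; apply: JA; exists r.
have := low _ (leqnn _).
rewrite [t / _ * _]divfK ?gt_eqF// -/I tot [q * n.+1%:R]divfK ?gt_eqF//.
apply/negP; rewrite -ltNge.
apply: (@lt_le_trans _ _ ((q * k%:R)%:E + (c / 2)%:E)%E).
  by rewrite lteD2lE.
rewrite -EFinD lee_fin.
suff : q * k%:R <= c / 2 by lra.
rewrite /q mulrAC ler_pdivrMr// -mulrA ler_pM2l//.
by rewrite mulrC ler_pdivlMr// -natrM ler_nat mulnC /n.
Qed.

End esum_intervals.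

(** * Jumps and variation of càdlàg paths *)

Section paths.
Context d (U : measurableType d) (R : realType).
Variable X : R -> U -> R.
Hypothesis cadlagX : cadlag_paths X.
Implicit Types (s t e : R) (w : U).

(** The passage between jumps and increments: the short intervals considered straddle [t], with
    [r < t <= r']. *)
Lemma jump_increment w t e : 0 < t -> 0 < e ->
  exists2 e', 0 < e' & forall r r', t - e' < r < t -> t <= r' < t + e' ->
    `|X r' w - X r w - jump X w t| < e.
Proof.
move=> t0 e0; have e20 : 0 < e / 2 by rewrite divr_gt0.
have [e1 e10 H1] := cadlag_right cadlagX w (ltW t0) e20.
have [e2 e20' H2] := cadlag_left cadlagX w t0 e20.
exists (Num.min e1 e2); first by rewrite lt_min e10.
move=> r r' /andP[h1 h2] /andP[h3 h4].
have /H1 : t <= r' < t + e1.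
  by rewrite h3 (lt_le_trans h4)// lerD2l ge_min lexx.
have /H2 : t - e2 < r < t.
  by rewrite h2 andbT (le_lt_trans _ h1)// lerD2l lerN2 ge_min lexx orbT.
rewrite /jump; set l := lim _; rewrite !ltr_norml => /andP[? ?] /andP[? ?].
by apply/andP; split; lra.
Qed.

Lemma jump_le_oscillation w (p q t c e : R) : p < t < q -> 0 <= p ->
  (forall r, p < r < q -> `|X r w - c| < e) -> `|jump X w t| <= 2 * e.
Proof.
move=> /andP[pt tq] p0 H; have t0 : 0 < t by exact: le_lt_trans pt.
apply/ler_addgt0Pr => e1 e10.
have [e' e'0 K] := jump_increment w t0 e10.
pose r := (Num.max p (t - e') + t) / 2.
have pm : p <= Num.max p (t - e') by rewrite le_max lexx.
have em : t - e' <= Num.max p (t - e') by rewrite le_max lexx orbT.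
have mt : Num.max p (t - e') < t by rewrite gt_max pt ltrBlDr ltrDl e'0.
have [/andP[rm rt]] : Num.max p (t - e') < r < t by rewrite /r; apply/andP; split; lra.
have /H : p < r < q by apply/andP; split; lra.
have /H : p < t < q by rewrite pt.
have := K r t; rewrite rt lexx ltrDl e'0 (le_lt_trans em rm) => /(_ isT isT).
rewrite !ltr_norml ler_norml => /andP[? ?] /andP[? ?] /andP[? ?].
by apply/andP; split; lra.
Qed.

(** The oscillation is small on a punctured one-sided neighbourhood and bounds the jumps there. With
    [e = W] this isolates the negative jumps of a regular path. *)
Lemma jump_small_right w s e : 0 <= s -> 0 < e ->
  exists2 e', 0 < e' & forall r, s < r < s + e' -> `|jump X w r| < e.
Proof.
move=> s0 e0; have e30 : 0 < e / 3 by rewrite divr_gt0.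
have [e' e'0 H] := cadlag_right cadlagX w s0 e30.
exists e' => // r /andP[sr rs].
apply: (@le_lt_trans _ _ (2 * (e / 3))); last by lra.
apply: (@jump_le_oscillation w s (s + e') r (X s w)) => //; first by rewrite sr.
by move=> r' /andP[h1 h2]; apply: H; rewrite (ltW h1).
Qed.

Lemma jump_small_left w t e : 0 < t -> 0 < e ->
  exists2 e', 0 < e' <= t & forall r, t - e' < r < t -> `|jump X w r| < e.
Proof.
move=> t0 e0; have e30 : 0 < e / 3 by rewrite divr_gt0.
have [e' e'0 H] := cadlag_left cadlagX w t0 e30.
exists (Num.min e' t); first by rewrite lt_min e'0 t0 ge_min lexx orbT.
move=> r /andP[rt tr].
apply: (@le_lt_trans _ _ (2 * (e / 3))); last by lra.
apply: (@jump_le_oscillation w (t - Num.min e' t) t r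
  (lim (X r w @[r --> t^'-]))) => //; first by rewrite rt.
  by rewrite subr_ge0 ge_min lexx orbT.
move=> r' /andP[h1 h2]; apply: H; rewrite h2 andbT (le_lt_trans _ h1)//.
by rewrite lerD2l lerN2 ge_min lexx.
Qed.

(** Equating [jump_sum] with a real number forces the positive and the negative jumps to be summable
    separately. *)
Definition regular (g W : R) (w : U) : Prop :=
  [/\ X 0 w = 0,
      forall t, 0 <= t -> (X t w)%:E = ((g * t)%R%:E + jump_sum X w t)%E &
      forall t, 0 < t -> jump X w t < 0 -> jump X w t <= - W].

Variables (g W : R).

(** The sums over ]0, s] and ]s, t] are nonnegative and their differences are real, hence all are
    finite and may be subtracted in [R]. *)
Lemma regular_increment w s t : regular g W w -> 0 <= s <= t ->
  exists p n : R, [/\ 0 <= p, 0 <= n,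
    \esum_(r in [set r | s < r <= t]) (Num.max (jump X w r) 0)%:E = p%:E,
    \esum_(r in [set r | s < r <= t]) (Num.max (- jump X w r) 0)%:E = n%:E &
    X t w - X s w = g * (t - s) + p - n].
Proof.
move=> [_ XE _] /andP[s0 st]; have t0 := le_trans s0 st.
pose fp r := (Num.max (jump X w r) 0)%:E.
pose fn r := (Num.max (- jump X w r) 0)%:E.
have fp0 r : (0 <= fp r)%E by rewrite lee_fin le_max lexx orbT.
have fn0 r : (0 <= fn r)%E by rewrite lee_fin le_max lexx orbT.
have st' : 0 <= s <= t by rewrite s0.
have := XE t t0; have := XE s s0; rewrite /jump_sum.
rewrite -/fp -/fn (@esum_itv_cat _ fp 0 s t)// (@esum_itv_cat _ fn 0 s t)//.
have := esum_ge0 (S := [set r | s < r <= t]) (fun r _ => fp0 r).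
have := esum_ge0 (S := [set r | s < r <= t]) (fun r _ => fn0 r).
have := esum_ge0 (S := [set r | 0 < r <= s]) (fun r _ => fp0 r).
have := esum_ge0 (S := [set r | 0 < r <= s]) (fun r _ => fn0 r).
rewrite -/(esum _ fp) -/(esum _ fn).
set a1 := esum _ fn; set a2 := esum _ fp; set a3 := esum _ fn; set a4 := esum _ fp.
move: a1 a2 a3 a4 => [a1| |]// [a2| |]// [a3| |]// [a4| |]//=.
rewrite -!EFinD !lee_fin => _ _ a30 a40 [h1] [h2].
by exists a4, a3; split => //; rewrite h1 h2; lra.
Qed.

Lemma regular_deviation w s t : regular g W w -> 0 <= s <= t ->
  ((`|X t w - X s w - g * (t - s)|)%:E <=
    \esum_(r in [set r | (s < r <= t)%R]) `|jump X w r|%:E)%E /\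
  (\esum_(r in [set r | (s < r <= t)%R]) `|jump X w r|%:E < +oo)%E.
Proof.
move=> rw st; have [p [n [p0 n0 pE nE ->]]] := regular_increment rw st.
suff -> : \esum_(r in [set r | s < r <= t]) `|jump X w r|%:E = (p + n)%:E.
  split; last exact: ltry.
  by rewrite lee_fin ler_norml; apply/andP; split; lra.
rewrite EFinD -pE -nE -esumD; [|by move=> r _; rewrite lee_fin le_max lexx orbT..].
apply: eq_esum => r _; rewrite -EFinD; congr EFin.
have [j0|j0] := leP 0 (jump X w r).
  by rewrite ger0_norm// max_r ?oppr_le0// addr0.
by rewrite ltr0_norm// max_l ?add0r// oppr_ge0 ltW.
Qed.

Lemma regular_growth w s t : regular g W w -> 0 <= s <= t ->
  (forall r, s < r <= t -> 0 <= jump X w r) -> g * (t - s) <= X t w - X s w.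
Proof.
move=> rw st j0; have [p [n [p0 n0 pE nE ->]]] := regular_increment rw st.
suff : n = 0 by move=> ->; lra.
apply: EFin_inj; rewrite -nE esum1// => r /j0 jr.
by rewrite max_r// oppr_le0.
Qed.

(** Negative jumps have size at least [W], while those just after [s] are smaller. A jump at [s]
    itself does not matter, since increments from [r >= s] only collect jumps after [r]. *)
Lemma regular_right w s : 0 < W -> regular g W w -> 0 <= s ->
  exists2 e, 0 < e & forall r r', s <= r -> r <= r' < s + e ->
    g * (r' - r) <= X r' w - X r w.
Proof.
move=> W0 rw s0; have [e e0 H] := jump_small_right w s0 W0.
exists e => // r r' sr /andP[rr' r's].
apply: regular_growth => //; first by rewrite (le_trans s0 sr).
move=> u /andP[ru ur]; rewrite leNgt; apply/negP => ju.
have [_ _ /(_ u _ ju)] := rw.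
have u0 : 0 < u by rewrite (le_lt_trans _ ru)// (le_trans s0 sr).
move=> /(_ u0); apply/negP; rewrite -ltNge.
have /H : s < u < s + e by rewrite (le_lt_trans sr ru) (le_lt_trans ur r's).
by rewrite ltr_norml => /andP[].
Qed.

Lemma regular_left w t : 0 < W -> regular g W w -> 0 < t ->
  exists2 e, 0 < e <= t & forall r r', t - e < r -> r <= r' < t ->
    g * (r' - r) <= X r' w - X r w.
Proof.
move=> W0 rw t0; have [e /andP[e0 et] H] := jump_small_left w t0 W0.
exists e; rewrite ?e0// => r r' tr /andP[rr' r't].
have r0 : 0 < r by rewrite (le_lt_trans _ tr)// subr_ge0.
apply: regular_growth => //; first by rewrite (ltW r0).
move=> u /andP[ru ur]; rewrite leNgt; apply/negP => ju.
have [_ _ /(_ u (lt_trans r0 ru) ju)] := rw.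
apply/negP; rewrite -ltNge.
have /H : t - e < u < t by rewrite (lt_trans tr ru) (le_lt_trans ur r't).
by rewrite ltr_norml => /andP[].
Qed.

End paths.

(** * The support of the Lévy measure on the negative half-line *)

Section support.
Context (R : realType) (nu : {measure set R -> \bar R}).

(** Lindelöf argument: the null neighbourhoods are shrunk to rational intervals, which are countably
    many. *)
Lemma negligible_cover (A D : set R) : measurable D ->
  (forall x, A x -> exists U, [/\ open U, U x & nu (U `&` D) = 0%E]) ->
  nu.-negligible (A `&` D).
Proof.
move=> mD H.
pose itv (pq : rat * rat) : set R := `]ratr pq.1, ratr pq.2[%classic.
have mitv pq : measurable (itv pq) by exact: measurable_itv.
pose G (n : nat) : set R := if unpickle n is Some pq then
  if nu (itv pq `&` D) == 0%E then itv pq `&` D else set0 else set0.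
apply: (@negligibleS _ _ _ _ (\bigcup_n G n)); last first.
  apply: negligible_bigcup => n; rewrite /G.
  case: unpickle => [pq|]; last exact: negligible_set0.
  case: eqP => [nu0|_]; last exact: negligible_set0.
  by apply/negligibleP => //; apply: measurableI.
move=> x [Ax Dx]; have [U [oU Ux U0]] := H x Ax.
have [e /= e0 eU] : nbhs x U by exact: open_nbhs_nbhs.
have [p] := @rat_in_itvoo R (x - e) x (ltac:(by rewrite ltrBlDr ltrDl)).
rewrite in_itv/= => /andP[ep px].
have [q] := @rat_in_itvoo R x (x + e) (ltac:(by rewrite ltrDl)).
rewrite in_itv/= => /andP[xq qe].
have [n nE] : exists n, unpickle n = Some (p, q) by exact: (ex_intro _ _ (pickleK (p, q))).
exists n => //; rewrite /G nE.
have itvU : itv (p, q) `<=` U.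
  move=> y; rewrite /itv/= in_itv/= => /andP[py yq]; apply: eU.
  by rewrite /ball/= ltr_norml; apply/andP; split; lra.
rewrite (_ : nu _ == 0%E); last first.
  rewrite -measure_le0 -U0; apply: le_measure; rewrite ?inE.
  - exact: measurableI.
  - by apply: measurableI => //; exact: open_measurable.
  - exact: setSI.
by split => //; rewrite /itv/= in_itv/= px.
Qed.

Let S := measure_support (restr_npos nu).
Hypothesis hsupp : ~ S 0.
Hypothesis hneg : nu `]-oo, (0 : R)[%classic != 0%E.

Let supp_null x : ~ S x ->
  exists U, [/\ open U, U x & nu (U `&` `]-oo, 0]%classic) = 0%E].
Proof.
move=> Sx; apply: contrapT => H; apply: Sx => U oU Ux.
rewrite lt_neqAle measure_ge0 andbT eq_sym; apply/eqP => U0.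
by apply: H; exists U.
Qed.

Let supp_neg x : S x -> x < 0.
Proof.
move=> Sx; rewrite lt_neqAle; apply/andP; split.
  by apply/eqP => x0; apply: hsupp; rewrite -x0.
rewrite leNgt; apply/negP => x0.
have := Sx `]0, +oo[%classic (ltac:(exact: interval_open)).
rewrite /restr_npos /mrestr (_ : _ `&` _ = set0) ?measure0 ?ltxx.
  by move=> /(_ (ltac:(by rewrite /= in_itv/= x0))).
apply/seteqP; split => y //= []; rewrite !in_itv/= andbT => y0.
by rewrite leNgt y0.
Qed.

Let supp_sup : has_sup S.
Proof.
split; last by exists 0 => x /supp_neg/ltW.
apply: contrapT => S0; move/eqP: hneg; apply.
have : nu.-negligible (setT `&` `]-oo, (0 : R)]%classic).
  apply: negligible_cover => // x _; apply: supp_null => Sx.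
  by apply: S0; exists x.
rewrite setTI => nn; apply: measure_negligible => //.
apply: negligibleS nn => x; rewrite /= !in_itv/=; exact: ltW.
Qed.

Let supp_sup_in : S (sup S).
Proof.
move=> U oU Us; have [e /= e0 eU] : nbhs (sup S) U by exact: open_nbhs_nbhs.
have [x Sx xs] := sup_adherent e0 supp_sup.
apply: (Sx U oU); apply: eU; rewrite /ball/= ger0_norm; first by lra.
by rewrite subr_ge0; apply: ub_le_sup => //; case: supp_sup.
Qed.

(** The supremum belongs to the support, which is closed, and is therefore negative like all its
    points. *)
Lemma gap_gt0 : 0 < - sup S.
Proof. by rewrite oppr_gt0; exact: supp_neg. Qed.

Lemma gap_null : nu `]sup S, (0 : R)[%classic = 0%E.
Proof.
apply: measure_negligible; first exact: measurable_itv.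
apply: (@negligibleS _ _ _ _ (`]sup S, (0 : R)[%classic `&` `]-oo, (0 : R)]%classic)).
  by move=> x; rewrite /= !in_itv/= => /andP[-> /[dup] + /ltW]; split.
apply: negligible_cover => // x; rewrite /= in_itv/= => /andP[sx _].
apply: supp_null => Sx; move: sx; rewrite ltNge => /negP; apply.
by apply: ub_le_sup => //; case: supp_sup.
Qed.

Lemma gap_edge e : 0 < e -> (0 < nu `](sup S - e)%R, (sup S + e)%R[%classic)%E.
Proof.
move=> e0; have := supp_sup_in (U := `](sup S - e)%R, (sup S + e)%R[%classic)
  (ltac:(exact: interval_open)).
rewrite /= in_itv/= ltrBlDr ltrDl e0 => /(_ isT) /lt_le_trans; apply.
by apply: le_measure; rewrite ?inE//; apply: measurableI.
Qed.

End support.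

(** * From the Lévy measure to the jumps of the paths *)

Section levy_paths.
Context d (T : measurableType d) (R : realType) (P : probability T R).
Variables (X : R -> T -> R) (nu : {measure set R -> \bar R}).
Hypothesis mX : forall t, 0 <= t -> measurable_fun setT (X t).
Hypothesis cadlagX : cadlag_paths X.
Hypothesis staX : stationary_increments P X.
Hypothesis indX : independent_increments P X.
Hypothesis hnu : is_levy_measure P X nu.
Implicit Types (s h e : R) (w : T).

(** A finite-increment trace of a jump in [p, q] during [k, k + 1]; by stationarity its probability
    does not depend on [k]. *)
Let some_increment (p q : R) (k n : nat) : set T :=
  [set w | exists2 i, (i < n.+1)%N & p <= X (grid k%:R n.+1%:R^-1 i.+1) w -
                                  X (grid k%:R n.+1%:R^-1 i) w <= q].

Let some_incrementE p q k n : some_increment p q k n =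
  ~` slab X n.+1 (grid k%:R n.+1%:R^-1) (fun=> ~` `[p, q]%classic).
Proof.
apply/seteqP; split => w /=.
  by move=> [i ni pq] /(_ i ni); apply; rewrite /= in_itv.
apply: contra_notP => H i ni /=; rewrite in_itv/= => pq.
by apply: H; exists i.
Qed.

Let gridS' k n i : grid (k%:R : R) n.+1%:R^-1 i <= grid k%:R n.+1%:R^-1 i.+1.
Proof. exact: gridS. Qed.

Let measurable_some_increment p q k n : measurable (some_increment p q k n).
Proof.
rewrite some_incrementE; apply: measurableC; apply: measurable_slab => //.
  by rewrite grid0.
by move=> _; exact: measurableC.
Qed.

(** Infinitely many meshes have a cell with increment in [p, q]. These cells accumulate at some [t],
    and the càdlàg property forces late ones to straddle [t], so that their increments approach the
    jump. *)
Let some_increment_jump p q w : q < 0 -> lim_sup_set (some_increment p q 0) w ->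
  jump_times X `[p, q]%classic w !=set0.
Proof.
move=> q0 H.
have /choice[f Hf] n : exists mi : nat * nat, [/\ (n <= mi.1)%N, (mi.2 < mi.1.+1)%N &
    p <= X (mi.2.+1%:R / mi.1.+1%:R) w - X (mi.2%:R / mi.1.+1%:R) w <= q].
  have [m nm [i im]] := H n I; rewrite /grid !add0r ![_^-1 * _]mulrC => pq.
  by exists (m, i).
pose x n := (f n).2%:R / (f n).1.+1%:R : R.
pose y n := (f n).2.+1%:R / (f n).1.+1%:R : R.
have x0 n : 0 <= x n by rewrite divr_ge0.
have yE n : y n = x n + (f n).1.+1%:R^-1 by rewrite /y -natr1 mulrDl mul1r.
have y1 n : y n <= 1.
  by rewrite /y ler_pdivrMr ?ltr0n// mul1r ler_nat; case: (Hf n).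
have xy n : x n < y n by rewrite yE ltrDl invr_gt0 ltr0n.
have [|t /andP[t0 t1] clt] := @cluster_seq R x 0 1.
  by move=> n; rewrite x0 (le_trans (ltW (xy n))).
have near e : 0 < e -> exists n, t - e < x n /\ y n < t + e.
  move=> e0; have e20 : 0 < e / 2 by rewrite divr_gt0.
  have [N HN] := mesh_lt e20.
  have [n Nn] := clt _ N e20; rewrite ltr_norml => /andP[h1 h2].
  exists n; rewrite yE; split; first by lra.
  have : (f n).1.+1%:R^-1 < e / 2.
    apply: le_lt_trans HN; rewrite lef_pV2 ?posrE ?ltr0n// ler_nat ltnS.
    by rewrite (leq_trans Nn)//; case: (Hf n).
  by move: (_^-1) => z hz; lra.
have incr n : p <= X (y n) w - X (x n) w <= q by case: (Hf n).
(* Two positions within [- q / 2] of the same one-sided limit differ by less than [- q]: a cell on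
   one side of [t] cannot have an increment at most [q]. *)
have q20 : 0 < - q / 2 by rewrite divr_gt0// oppr_gt0.
have [e1 e10 H1] := cadlag_right cadlagX w t0 q20.
move: t0; rewrite le_eqVlt => /predU1P[tE|t0].
  have [n [_ yn]] := near _ e10; have := xy n.
  have /H1 : t <= x n < t + e1 by rewrite -tE x0/= add0r (lt_trans (xy n))// -[e1]add0r tE.
  have /H1 : t <= y n < t + e1 by rewrite -{1}tE yn andbT (le_trans (x0 n))// ltW.
  rewrite !ltr_norml => /andP[? ?] /andP[? ?] _.
  by have /andP[? ?] := incr n; exfalso; lra.
have [e2 e20 H2] := cadlag_left cadlagX w t0 q20.
exists t; suff jpq : p <= jump X w t <= q.
  split => //; apply/eqP => j0; move: jpq; rewrite j0 => /andP[_]; by rewrite leNgt q0.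
have close e : 0 < e -> exists z, p <= z <= q /\ `|z - jump X w t| < e.
  move=> e0; have [e3 e30 H3] := jump_increment cadlagX w t0 e0.
  have [|n [xn yn]] := near (Num.min (Num.min e1 e2) e3).
    by rewrite !lt_min e10 e20.
  have m1 : Num.min (Num.min e1 e2) e3 <= e1 by rewrite !ge_min lexx.
  have m2 : Num.min (Num.min e1 e2) e3 <= e2 by rewrite !ge_min lexx orbT.
  have m3 : Num.min (Num.min e1 e2) e3 <= e3 by rewrite !ge_min lexx !orbT.
  exists (X (y n) w - X (x n) w); split => //.
  have /andP[? ?] := incr n; have xyn := xy n.
  have [yt|ty] := ltP (y n) t.
    have /H2 : t - e2 < x n < t by apply/andP; split; lra.
    have /H2 : t - e2 < y n < t by apply/andP; split; lra.
    by rewrite !ltr_norml => /andP[? ?] /andP[? ?]; exfalso; lra.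
  have [tx|xt] := leP t (x n).
    have /H1 : t <= x n < t + e1 by apply/andP; split; lra.
    have /H1 : t <= y n < t + e1 by apply/andP; split; lra.
    by rewrite !ltr_norml => /andP[? ?] /andP[? ?]; exfalso; lra.
  by apply: H3; apply/andP; split; lra.
by apply/andP; split; apply/ler_addgt0Pr => e e0; have [z [/andP[? ?]]] := close e e0;
  rewrite ltr_norml => /andP[? ?]; lra.
Qed.

(* The Lévy measure only records jumps in ]0, 1]; stationarity carries the
   information over to all times, through increments over finer and finer
   meshes. *)
Lemma jump_negligible p q : q < 0 -> nu `[p, q]%classic = 0%E ->
  P.-negligible [set w | exists2 t, 0 < t & p < jump X w t < q].
Proof.
move=> q0 nu0.
(* A jump strictly between [p] and [q] is seen by all fine meshes, a liminf event; on [0, 1] even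
   the limsup event is null. [liminf_negligible] links the two. *)
apply: (@negligibleS _ _ _ _ (\bigcup_k \bigcup_n \bigcap_(m in [set m | (n <= m)%N])
  some_increment p q k m)); last first.
  apply: negligible_bigcup => k.
  apply: (@liminf_negligible _ _ _ _ _ (some_increment p q 0)) => // [n|].
    rewrite !some_incrementE !probability_setC; last 2 first.
    - by apply: measurable_slab => // [|_]; [rewrite grid0|exact: measurableC].
    - by apply: measurable_slab => // [|_]; [rewrite grid0|exact: measurableC].
    congr (_ - _)%E; apply: slab_grid_prob => // _; exact: measurableC.
  have mls : measurable (lim_sup_set (some_increment p q 0)).
    apply: bigcapT_measurable => n; apply: bigcup_measurable => m _.
    exact: measurable_some_increment.
  apply/negligibleP => //; apply: (@integral_counting_null _ _ _ _ _
    (jump_times X `[p, q]%classic)) => //.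
    by move=> w; exact: some_increment_jump.
  by rewrite -hnu.
move=> w [t t0 /andP[pj jq]].
pose e := Num.min (jump X w t - p) (q - jump X w t).
have e0 : 0 < e by rewrite lt_min !subr_gt0 pj.
have m1 : e <= jump X w t - p by rewrite ge_min lexx.
have m2 : e <= q - jump X w t by rewrite ge_min lexx orbT.
have [e' e'0 H] := jump_increment cadlagX w t0 e0.
have [k /andP[kt tk]] := mesh_cell 0 t0; rewrite !divr1 in kt tk.
have [n hn] := mesh_lt e'0.
exists k => //; exists n => // m /= nm.
have tk0 : 0 < t - k%:R by rewrite subr_gt0.
have [i /andP[it ti]] := mesh_cell m tk0.
have m0 : 0 < m.+1%:R :> R by rewrite ltr0n.
exists i.
  rewrite -(ltr_nat R) -(ltr_pM2r (x := m.+1%:R^-1)) ?invr_gt0// divff ?gt_eqF//.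
  by apply: (lt_le_trans it); rewrite lerBlDl natr1.
have : m.+1%:R^-1 < e'.
  by apply: le_lt_trans hn; rewrite lef_pV2 ?posrE ?ltr0n// ler_nat ltnS.
have iE : i.+1%:R / m.+1%:R = i%:R / m.+1%:R + m.+1%:R^-1 :> R.
  by rewrite -natr1 mulrDl mul1r.
rewrite /grid ![m.+1%:R^-1 * _]mulrC.
move: it ti; rewrite iE; move: (i%:R / m.+1%:R) => u; move: (m.+1%:R^-1) => v it ti ve.
have := H (k%:R + u) (k%:R + (u + v)).
have -> : t - e' < k%:R + u < t by apply/andP; split; lra.
have -> : t <= k%:R + (u + v) < t + e' by apply/andP; split; lra.
move=> /(_ isT isT); rewrite ltr_norml => /andP[? ?]; apply/andP; split; lra.
Qed.

(** Increments just before [t] have the law of increments just after 0, which vanish in the limit by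
    right-continuity. *)
Lemma fixed_jump_negligible (t W : R) : 0 < t -> 0 < W ->
  P.-negligible [set w | jump X w t <= - W].
Proof.
move=> t0 W0.
pose A n := [set w | X t w - X (t - t / n.+1%:R) w <= - W / 2].
pose B n := [set w | X (0 + t / n.+1%:R) w - X 0 w <= - W / 2].
have tn n : 0 <= t / n.+1%:R by rewrite divr_ge0// ltW.
have tn' n : 0 <= t - t / n.+1%:R.
  by rewrite subr_ge0 ler_pdivrMr ?ltr0n// ler_peMr ?(ltW t0)// ler1n.
have mhalf : measurable [set x : R | x <= - W / 2].
  by rewrite -set_itvNyc; exact: measurable_itv.
have mB n : measurable (B n).
  by apply: (measurable_incB mX (B := [set x | x <= - W / 2])); rewrite ?add0r.
apply: (@negligibleS _ _ _ _ (\bigcup_n \bigcap_(m in [set m | (n <= m)%N]) A m)).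
  move=> w /= jW; have W20 : 0 < W / 2 by rewrite divr_gt0.
  have [e e0 H] := jump_increment cadlagX w t0 W20.
  have et0 : 0 < e / t by rewrite divr_gt0.
  have [n hn] := mesh_lt et0; exists n => // m /= nm.
  have tm0 : 0 < t / m.+1%:R by rewrite divr_gt0 ?ltr0n.
  have tme : t / m.+1%:R < e.
    rewrite mulrC -ltr_pdivlMr//; apply: le_lt_trans hn.
    by rewrite lef_pV2 ?posrE ?ltr0n// ler_nat ltnS.
  have := H (t - t / m.+1%:R) t.
  have -> : t - e < t - t / m.+1%:R < t.
    by rewrite ltrD2l ltrN2 tme ltrBlDr ltrDl.
  have -> : t <= t < t + e by rewrite lexx ltrDl.
  move=> /(_ isT isT); rewrite ltr_norml /A/= => /andP[? ?]; lra.
apply: (@liminf_negligible _ _ _ _ _ B) => // [n|n|].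
- by apply: (measurable_incB mX (B := [set x | x <= - W / 2])) => //; exact: ltW.
- by have := staX (tn' n) (lexx 0) (tn n) mhalf; rewrite subrK.
- rewrite (_ : lim_sup_set B = set0); first exact: negligible_set0.
  apply/seteqP; split => w // H.
  have W20 : 0 < W / 2 by rewrite divr_gt0.
  have [e e0 K] := cadlag_right cadlagX w (lexx 0) W20.
  have et0 : 0 < e / t by rewrite divr_gt0.
  have [n hn] := mesh_lt et0; have [m /= nm] := H n I; rewrite /B/=.
  have := K (0 + t / m.+1%:R); rewrite !add0r tn /=.
  have -> : t / m.+1%:R < e.
    rewrite mulrC -ltr_pdivlMr//; apply: le_lt_trans hn.
    by rewrite lef_pV2 ?posrE ?ltr0n// ler_nat ltnS.
  by move=> /(_ isT); rewrite ltr_norml => /andP[? ?] ?; lra.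
Qed.

End levy_paths.

(** * Adapted processes and the vanishing Gaussian part *)

Section adapted_processes.
Context d (T : measurableType d) (R : realType) (P : probability T R).
Variables (F : R -> set (set T)).
Hypothesis hF : filtration F.

Lemma measurable_adapted (X : R -> T -> R) t : adapted F X -> 0 <= t ->
  measurable_fun setT (X t).
Proof.
move=> aX t0 _ B mB; rewrite setTI.
by have [_ + _] := hF; apply; [exact: t0|exact: aX].
Qed.

(** Variance 0 makes [G] vanish almost surely at all rational times, and right-continuity extends
    this to all times. *)
Lemma degenerate_gaussian_negligible (G : R -> T -> R) :
  driftless_gaussian_levy P F 0 G ->
  P.-negligible [set w | exists2 t, 0 <= t & G t w != 0].
Proof.
move=> [[aG cG _ _ _] GE].
have mG t : 0 <= t -> measurable (~` (G t @^-1` [set 0])).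
  move=> t0; apply: measurableC; rewrite -[X in measurable X]setTI.
  exact: (measurable_adapted aG t0).
apply: (@negligibleS _ _ _ _ (\bigcup_n \bigcup_k
    ~` (G (k%:R / n.+1%:R) @^-1` [set 0]))); last first.
  apply: negligible_bigcup => n; apply: negligible_bigcup => k.
  have kn0 : 0 <= k%:R / n.+1%:R :> R by rewrite divr_ge0.
  apply/negligibleP; first exact: mG.
  have mA : measurable (G (k%:R / n.+1%:R) @^-1` [set 0]).
    by rewrite -[X in measurable X]setTI; exact: (measurable_adapted aG kn0).
  have := probability_setC P mA; rewrite GE// /centred_gaussian mul0r eqxx.
  by rewrite diracE mem_set// subee.
move=> w [t t0 Gt0]; have G0 : 0 < `|G t w| by rewrite normr_gt0.
have [e e0 H] := cadlag_right cG w t0 G0.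
have [n [k /andP[tk kt]]] := rational_right t0 e0.
exists n => //; exists k => //= Gk.
have := H (k%:R / n.+1%:R); rewrite Gk (ltW tk) kt sub0r normrN => /(_ isT).
by rewrite ltxx.
Qed.

End adapted_processes.

(** * Shapes of the two elementary moves *)

Section tubes.
Context (R : realType).
Implicit Types (W e h g u : R).

(** The time of the downward step is left free: the band allows positions before and after it, and
    only the end time requires that it has been made. *)
Definition down_tube W e h u : set R :=
  if u == h then `[- W - e, - W + e]%classic else `[- W - e, e]%classic.

Lemma right_closed_down W e h : right_closed h (down_tube W e h).
Proof.
split=> [u|u x /andP[u0 uh]]; first by rewrite /down_tube; case: ifP => _; exact: measurable_itv.
rewrite /down_tube (lt_eqF uh) /= in_itv/= => /negP.
rewrite negb_and -!ltNge => /orP[xe|ex].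
- exists (Num.min (h - u) (- W - e - x)); first by rewrite lt_min !subr_gt0 uh.
  move=> v y /andP[uv vu].
  have m1 : Num.min (h - u) (- W - e - x) <= h - u by rewrite ge_min lexx.
  have m2 : Num.min (h - u) (- W - e - x) <= - W - e - x by rewrite ge_min lexx orbT.
  rewrite lt_eqF; last by lra.
  by rewrite ltr_norml /= in_itv/= => /andP[? ?] /andP[? ?]; lra.
- exists (Num.min (h - u) (x - e)); first by rewrite lt_min !subr_gt0 uh.
  move=> v y /andP[uv vu].
  have m1 : Num.min (h - u) (x - e) <= h - u by rewrite ge_min lexx.
  have m2 : Num.min (h - u) (x - e) <= x - e by rewrite ge_min lexx orbT.
  rewrite lt_eqF; last by lra.
  by rewrite ltr_norml /= in_itv/= => /andP[? ?] /andP[? ?]; lra.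
Qed.

Definition drift_tube g e u : set R := [set x | `|x - g * u| <= e].

Lemma right_closed_drift g e h : right_closed h (drift_tube g e).
Proof.
split=> [u|u x _ /negP].
  rewrite (_ : drift_tube g e u = `[g * u - e, g * u + e]%classic).
    exact: measurable_itv.
  by apply/seteqP; split => x; rewrite /drift_tube/= in_itv/= ler_distl.
rewrite -ltNge => ex; pose q := `|x - g * u| - e.
have q0 : 0 < q by rewrite subr_gt0.
have g0 : 0 < `|g| + 1 by rewrite ltr_wpDl.
(* The map [(v, y) -> |y - g v|] varies by at most [|g| + 1] times the sum of the two displacements;
   the factor 2 shares [q] between them. *)
exists (q / (`|g| + 1) / 2); first by rewrite !divr_gt0.
move=> v y /andP[uv vu] yx; apply/negP; rewrite -ltNge.
have vu0 : 0 <= v - u by rewrite subr_ge0.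
have : `|x - g * u| <= `|y - g * v| + `|y - x| + `|g| * (v - u).
  rewrite -[v - u in leRHS]ger0_norm// -normrM -[`|y - x|]normrN.
  by apply: (le_trans _ (le_trans (ler_normD _ _) (lerD (ler_normD _ _) (lexx _))));
    rewrite le_eqVlt; apply/orP; left; apply/eqP; congr Num.norm; ring.
have : (`|g| + 1) * (v - u) + (`|g| + 1) * `|y - x| < q.
  rewrite -mulrDr mulrC -ltr_pdivlMr//.
  by move: vu yx; move: (q / _) => z; lra.
have : 0 <= `|g| * `|y - x| by rewrite mulr_ge0.
by rewrite /q; lra.
Qed.

End tubes.

(** * Positive probability of the two elementary moves *)

Section tube_positivity.
Context d (T : measurableType d) (R : realType) (P : probability T R).
Variables (X : R -> T -> R) (nu : {measure set R -> \bar R}).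
Hypothesis mX : forall t, 0 <= t -> measurable_fun setT (X t).
Hypothesis cadlagX : cadlag_paths X.
Hypothesis staX : stationary_increments P X.
Hypothesis indX : independent_increments P X.
Implicit Types (s h e W g : R) (w : T).

(** On [D] some jump is close to [- W], and a fine enough mesh cell around it is a [down_tube]. Were
    the tubes of every length [1 / n.+1] null, countably many null events would cover [D]. The
    length [h] is thus not explicit. *)
Lemma down_tube_gt0 W e : is_levy_measure P X nu -> 0 < W -> 0 < e ->
  (0 < nu `](- W - e)%R, (- W + e)%R[%classic)%E ->
  exists2 h, 0 < h & forall s, 0 <= s -> (0 < P (tube X s h (down_tube W e h)))%E.
Proof.
move=> hnu W0 e0; rewrite hnu; last exact: measurable_itv.
move=> /integral_counting_pos[D [mD PD DJ]].
apply: contrapT => H.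
have tube0 n k : P (tube X (k%:R / n.+1%:R) n.+1%:R^-1
    (down_tube W e n.+1%:R^-1)) = 0%E.
  apply/eqP; rewrite eq_le measure_ge0 andbT leNgt; apply/negP => Pt.
  apply: H; exists n.+1%:R^-1; first by rewrite invr_gt0.
  move=> s s0; rewrite (@tube_prob _ _ _ _ X mX cadlagX staX indX s (k%:R / n.+1%:R))//.
  exact: right_closed_down.
have : P.-negligible D.
  apply: (@negligibleS _ _ _ _ (\bigcup_n \bigcup_k
    tube X (k%:R / n.+1%:R) n.+1%:R^-1 (down_tube W e n.+1%:R^-1))); last first.
    apply: negligible_bigcup => n; apply: negligible_bigcup => k.
    apply/negligibleP; last exact: tube0.
    apply: (measurable_tube mX cadlagX staX indX) => //.
    exact: right_closed_down.
  move=> w /DJ[t [t0 t1 _]]; rewrite /= in_itv/= => /andP[j1 j2].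
  (* The first two terms are the margins of the jump in its open interval; [e / 2] serves before the
     jump, where two positions within [q] of the left limit are compared. *)
  pose q := Num.min (Num.min (e - (jump X w t + W)) (e + (jump X w t + W))) (e / 2).
  have q0 : 0 < q by rewrite !lt_min divr_gt0// andbT; apply/andP; split; lra.
  have q1 : q <= e - (jump X w t + W) by rewrite !ge_min lexx.
  have q2 : q <= e + (jump X w t + W) by rewrite !ge_min lexx orbT.
  have q3 : q <= e / 2 by rewrite !ge_min lexx orbT.
  have [e1 e10 H1] := jump_increment cadlagX w t0 q0.
  have [e2 e20 H2] := cadlag_left cadlagX w t0 q0.
  have m0 : 0 < Num.min e1 e2 by rewrite lt_min e10.
  have m1 : Num.min e1 e2 <= e1 by rewrite ge_min lexx.
  have m2 : Num.min e1 e2 <= e2 by rewrite ge_min lexx orbT.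
  have [n hn] := mesh_lt m0.
  have [k /andP[kt tk]] := mesh_cell n t0.
  exists n => //; exists k => //.
  have kE : k.+1%:R / n.+1%:R = k%:R / n.+1%:R + n.+1%:R^-1 :> R.
    by rewrite -natr1 mulrDl mul1r.
  move: kt tk; rewrite kE; move: (k%:R / n.+1%:R) hn => s; move: (n.+1%:R^-1) => h hn st th.
  have late u : t <= s + u -> u <= h -> `|X (s + u) w - X s w - jump X w t| < q.
    by move=> tu uh; apply: H1; apply/andP; split; lra.
  move=> u /andP[u0 uh]; rewrite /down_tube; case: eqP => [->|_].
    have := late h th (lexx _); rewrite ltr_norml /= in_itv/= => /andP[? ?].
    by apply/andP; split; lra.
  have [tu|ut] := leP t (s + u).
    have := late u tu uh; rewrite ltr_norml /= in_itv/= => /andP[? ?].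
    by apply/andP; split; lra.
  have /H2 : t - e2 < s < t by apply/andP; split; lra.
  have /H2 : t - e2 < s + u < t by apply/andP; split; lra.
  rewrite !ltr_norml /= in_itv/= => /andP[? ?] /andP[? ?].
  by apply/andP; split; lra.
by move=> /(measure_negligible mD) PD0; move: PD; rewrite PD0 ltxx.
Qed.

Lemma expe_gt0 (x : \bar R) n : (0 < x)%E -> (0 < x ^+ n)%E.
Proof. by move=> x0; elim: n => [|n IH]; rewrite ?expe0 ?expeS ?lte01// mule_gt0. Qed.

(* If a tube of width e around the drift were null, so would be all the tubes of
   width e / n over the n-th parts of the interval; a path of finite variation
   without continuous part cannot leave all of these. *)
Lemma drift_tube_gt0 W g t e s : P.-negligible (~` [set w | regular X g W w]) ->
  0 < t -> 0 < e -> 0 <= s -> (0 < P (tube X s t (drift_tube g e)))%E.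
Proof.
move=> reg t0 e0 s0; rewrite lt_neqAle measure_ge0 andbT eq_sym; apply/eqP.
rewrite (@tube_prob _ _ _ _ X mX cadlagX staX indX s 0)//; last exact: right_closed_drift.
move=> Pt0.
pose h n := t / n.+1%:R.
have h0 n : 0 < h n by rewrite divr_gt0.
have hi n i : 0 <= h n * i%:R by rewrite mulr_ge0// ltW.
have en n : 0 < e / n.+1%:R by rewrite divr_gt0.
have tube0 n i : P (tube X (h n * i%:R) (h n) (drift_tube g (e / n.+1%:R))) = 0%E.
  rewrite (@tube_prob _ _ _ _ X mX cadlagX staX indX _ 0)//; last exact: right_closed_drift.
  apply/eqP; rewrite eq_le measure_ge0 andbT leNgt; apply/negP => Pt.
  have rc : right_closed (h n) (drift_tube g (e / n.+1%:R)) by exact: right_closed_drift.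
  have [[mI _] PI] := tube_iter mX cadlagX staX indX n.+1 (h0 n) rc.
  have : (0 < P (tube X 0 t (drift_tube g e)))%E; last by rewrite Pt0 ltxx.
  apply: (lt_le_trans (expe_gt0 n.+1 Pt)); rewrite -PI.
  apply: le_measure; rewrite ?inE//.
    by apply: (measurable_tube mX cadlagX staX indX) => //; exact: right_closed_drift.
  move=> w /= H.
  (* Each part adds at most [e / n.+1] to the deviation, so that [n.+1] parts stay within [e]. *)
  have K k : (k <= n.+1)%N -> forall u, 0 <= u <= h n * k%:R ->
      `|X u w - X 0 w - g * u| <= k%:R * (e / n.+1%:R).
    elim: k => [_ u|k IH kn u /andP[u0 uk]].
      rewrite mulr0 => /le_anti <-; by rewrite !mulr0 subr0 subrr normr0 mul0r.
    have [uk'|ku] := leP u (h n * k%:R).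
      rewrite (le_trans (IH (ltnW kn) u _)) ?u0//.
      by rewrite ler_pM2r// ler_nat.
    have := IH (ltnW kn) (h n * k%:R); rewrite lexx hi => /(_ isT) I1.
    have uE : h n * k%:R + (u - h n * k%:R) = u by rewrite addrC subrK.
    have := H k kn (u - h n * k%:R); rewrite /drift_tube/= uE.
    rewrite subr_ge0 (ltW ku) lerBlDr -{1}[h n]mul1r mulrC -mulrDr nat1r uk => /(_ isT).
    move: I1; rewrite -[in X in _ -> _ -> X]natr1 mulrDl mul1r mulrBr.
    move: (k%:R * (e / n.+1%:R)) => A; move: (e / n.+1%:R) => B.
    move: (g * (h n * k%:R)) (g * u) => x y.
    by rewrite !ler_norml => /andP[? ?] /andP[? ?]; apply/andP; split; lra.
  move=> u ut; rewrite add0r /drift_tube/=.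
  have := K n.+1 (leqnn _) u; rewrite /h divfK ?gt_eqF ?ltr0n// ut => /(_ isT).
  by rewrite mulrCA divff ?mulr1// gt_eqF ?ltr0n.
have : P.-negligible setT.
  apply: (@negligibleS _ _ _ _ (~` [set w | regular X g W w] `|`
    \bigcup_n \bigcup_i tube X (h n * i%:R) (h n) (drift_tube g (e / n.+1%:R)))).
    move=> w _; apply: contrapT => /not_orP[/contrapT rw nt].
    have ge0 r : (0 <= `|jump X w r|%:E)%E by rewrite lee_fin.
    have t00 : 0 <= (0 : R) <= t by rewrite lexx ltW.
    apply: (esum_mesh_contra ge0 t0 e0 (regular_deviation rw t00).2) => n i ni.
    have : ~ tube X (h n * i%:R) (h n) (drift_tube g (e / n.+1%:R)) w.
      by move=> tw; apply: nt; exists n => //; exists i.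
    move=> /existsNP[u /not_implyP[/andP[u0 uh]]].
    rewrite /drift_tube/= => /negP; rewrite -ltNge => eu.
    have uE : u = h n * i%:R + u - h n * i%:R by rewrite addrC addKr.
    have iu : 0 <= h n * i%:R <= h n * i%:R + u by rewrite hi lerDl.
    have [+ _] := regular_deviation rw iu; rewrite -uE.
    move=> dev; apply: (@lt_le_trans _ _ (`|X (h n * i%:R + u) w - X (h n * i%:R) w - g * u|)%:E).
      by rewrite lte_fin.
    apply: (le_trans dev); apply: le_ereal_sup => _ [A [fA AI] <-].
    exists A => //; split => // r /AI /= /andP[-> ru] /=.
    by rewrite (le_trans ru)// -/(h n) -[i.+1%:R]natr1 mulrDr mulr1 lerD2l.
  apply: negligibleU => //.
  apply: negligible_bigcup => n; apply: negligible_bigcup => i.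
  apply/negligibleP; last exact: tube0.
  by apply: (measurable_tube mX cadlagX staX indX) => //; exact: right_closed_drift.
move=> /(measure_negligible measurableT) PT0.
by have := probability_setT P; rewrite PT0 => /eqP; rewrite eq_sym onee_eq0.
Qed.

End tube_positivity.

(** * Almost sure regularity of the paths *)

Section regularity.
Context d (T : measurableType d) (R : realType) (P : probability T R).
Variables (F : R -> set (set T)) (X : R -> T -> R).
Variables (g : R) (nu : {measure set R -> \bar R}).
Hypothesis hF : filtration F.
Hypothesis hX : levy_process P F X.
Hypothesis hnu : is_levy_measure P X nu.
Hypothesis hdd : diffusion_and_drift P F X 0 g.

Lemma regular_ae W : nu `]- W, (0 : R)[%classic = 0%E ->
  P.-negligible (~` [set w | regular X g W w]).
Proof.
move=> nu0; have [aX cX X0 sX iX] := hX.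
have mX t : 0 <= t -> measurable_fun setT (X t) by exact: (measurable_adapted hF aX).
have [_ [G [hG XE]]] := hdd.
have G0 := degenerate_gaussian_negligible hF hG.
have J0 : P.-negligible [set w | exists2 t, 0 < t & - W < jump X w t < 0].
  (* Exhaustion from inside: [jump_negligible] needs an upper bound of the jumps that is itself
     negative. *)
  apply: (@negligibleS _ _ _ _ (\bigcup_n [set w | exists2 t, 0 < t &
      - W + n.+1%:R^-1 < jump X w t < - n.+1%:R^-1])).
    move=> w [t t0 /andP[j1 j2]].
    have [|n] := @mesh_lt R (Num.min (jump X w t + W) (- jump X w t)).
      by rewrite lt_min oppr_gt0 j2 andbT -ltrBlDr sub0r.
    rewrite lt_min => /andP[n1 n2]; exists n => //; exists t => //.
    by move: (n.+1%:R^-1) n1 n2 => z n1 n2; apply/andP; split; lra.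
  apply: negligible_bigcup => n; apply: (jump_negligible mX cX sX iX hnu).
    by rewrite oppr_lt0 invr_gt0.
  apply/eqP; rewrite -measure_le0 -nu0; apply: le_measure; rewrite ?inE//.
  have : 0 < n.+1%:R^-1 :> R by rewrite invr_gt0.
  move: (n.+1%:R^-1) => z z0 x; rewrite /= !in_itv/= => /andP[? ?].
  by apply/andP; split; lra.
apply: negligibleS (negligibleU (negligibleU X0 XE) (negligibleU G0 J0)).
move=> w; apply: contra_notP => /not_orP[/not_orP[/contrapT h1 /contrapT h2] /not_orP[h3 h4]].
split => // [t t0|t t0 jt].
  rewrite h2// (_ : G t w = 0) ?adde0//.
  by apply/eqP; apply: contra_notT h3 => Gt; exists t.
rewrite leNgt; apply/negP => Wj; apply: h4; exists t => //; by rewrite Wj.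
Qed.

End regularity.

(** * The exit time and the measurability of exit events *)

Section exit.
Context d (T : measurableType d) (R : realType) (P : probability T R).
Variables (X : R -> T -> R) (a b : R).
Hypothesis cadlagX : cadlag_paths X.
Implicit Types (s t m g W : R) (w : T).

Definition survives t w : Prop := forall s, 0 <= s <= t -> - b < X s w < a.

(** The infimum is attained: paths are right-continuous and the complement of ]-b, a[ is closed. *)
Lemma exit_timeP w :
  (exit_time X a b w = +oo%E /\ forall t, survives t w) \/
  exists2 r, 0 <= r & [/\ exit_time X a b w = r%:E, ~ (- b < X r w < a) &
    forall t, t < r -> survives t w].
Proof.
rewrite /exit_time; set S := [set t : R | _].
have [[s Ss]|S0] := pselect (S !=set0); last first.
  left; split.
    rewrite (_ : [set _ | _ in S] = set0) ?ereal_inf0//.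
    by apply/seteqP; split => x // [t St _]; apply: S0; exists t.
  move=> t s /andP[s0 _]; apply: contrapT => Xs; apply: S0; by exists s.
right.
have lS : has_lbound S by exists 0 => t [].
have iS : has_inf S by split => //; exists s.
have r0 : 0 <= inf S by apply: lb_le_inf; [by exists s|move=> t []].
exists (inf S) => //; split.
- by rewrite ereal_inf_EFin//; exists s.
- move=> /andP[bX Xa].
  have e0 : 0 < Num.min (X (inf S) w + b) (a - X (inf S) w).
    by rewrite lt_min subr_gt0 Xa andbT; lra.
  have m1 : Num.min (X (inf S) w + b) (a - X (inf S) w) <= X (inf S) w + b by rewrite ge_min lexx.
  have m2 : Num.min (X (inf S) w + b) (a - X (inf S) w) <= a - X (inf S) w by rewrite ge_min lexx orbT.
  have [e e0' H] := cadlag_right cadlagX w r0 e0.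
  have [t St te] := inf_adherent e0' iS; have [t0] := St; apply.
  have /H : inf S <= t < inf S + e by rewrite te andbT; apply: ge_inf.
  by rewrite ltr_norml => /andP[? ?]; apply/andP; split; lra.
- move=> t tr s' /andP[s0 st]; apply: contrapT => Xs.
  have : S s' by [].
  by move=> /(ge_inf lS); rewrite leNgt (le_lt_trans st tr).
Qed.

Lemma survives_exit t w : survives t w -> (t%:E < exit_time X a b w)%E.
Proof.
move=> H; have [[-> _]|[r r0 [-> Xr _]]] := exit_timeP w; first exact: ltry.
rewrite lte_fin ltNge; apply/negP => rt; apply: Xr; apply: H.
by rewrite r0.
Qed.

Lemma exit_survives t w : (t%:E < exit_time X a b w)%E -> survives t w.
Proof.
have [[_ H] _|[r r0 [-> Xr H]]] := exit_timeP w; first exact: H.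
by rewrite lte_fin; exact: H.
Qed.

Lemma exit_time_le w t : 0 <= t -> ~ (- b < X t w < a) ->
  exists2 r, 0 <= r <= t & [/\ exit_time X a b w = r%:E, ~ (- b < X r w < a) &
    forall s, s < r -> survives s w].
Proof.
move=> t0 Xt; have [[_ H]|[r r0 [E Xr H]]] := exit_timeP w.
  by exfalso; apply: Xt; apply: (H t); rewrite t0 lexx.
exists r => //; rewrite r0/= leNgt; apply/negP => /H K.
by apply: Xt; apply: K; rewrite t0 lexx.
Qed.

Definition plus_set m := [set w | [/\ (exit_time X a b w < +oo)%E,
  a <= X (fine (exit_time X a b w)) w & `[m, +oo[%classic (fine (exit_time X a b w))]].

Definition minus_set m := [set w | [/\ (exit_time X a b w < +oo)%E,
  X (fine (exit_time X a b w)) w <= - b & `[m, +oo[%classic (fine (exit_time X a b w))]].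

Lemma exit_plus m t w : 0 <= t -> survives m w -> a <= X t w ->
  (forall s, 0 <= s <= t -> - b < X s w) -> plus_set m w.
Proof.
move=> t0 sm aX bX.
have [|r /andP[r0 rt] [E Xr _]] := @exit_time_le w t t0.
  by move=> /andP[_]; rewrite ltNge aX.
have := survives_exit sm; rewrite /plus_set/= E ltry /= lte_fin => mr.
split => //; last by rewrite in_itv/= andbT ltW.
by move/negP: Xr; rewrite bX ?r0//= -leNgt.
Qed.

Lemma exit_minus m t w : 0 <= t -> survives m w -> X t w <= - b ->
  (forall s, 0 <= s <= t -> X s w < a) -> minus_set m w.
Proof.
move=> t0 sm bX aX.
have [|r /andP[r0 rt] [E Xr _]] := @exit_time_le w t t0.
  by move=> /andP[]; rewrite ltNge bX.
have := survives_exit sm; rewrite /minus_set/= E ltry /= lte_fin => mr.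
split => //; last by rewrite in_itv/= andbT ltW.
by move/negP: Xr; rewrite aX ?r0//= andbT -leNgt.
Qed.

Hypothesis mX : forall t, 0 <= t -> measurable_fun setT (X t).
Hypothesis complete : P.-negligible `<=` measurable.
Variables (g W : R).
Hypothesis g0 : 0 < g.
Hypothesis W0 : 0 < W.
Hypothesis reg : P.-negligible (~` [set w | regular X g W w]).

Let rat n k : R := k%:R / n.+1%:R.

(* Between its isolated negative jumps a regular path increases: reaching a at
   time s makes it exceed a just after s, and its left limits at -b are
   approached from below. *)
Definition rational_survives t : set T :=
  [set w | [/\ - b < X t w, X t w < a,
    forall n k : nat, rat n k < t -> X (rat n k) w <= a &
    exists j : nat, forall n k : nat, rat n k < t ->
      - b + j.+1%:R^-1 <= X (rat n k) w]].

Let rat0 n k : 0 <= rat n k. Proof. exact: divr_ge0. Qed.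

Lemma measurable_level (B : set R) t : measurable B -> 0 <= t ->
  measurable [set w | B (X t w)].
Proof.
by move=> mB t0; rewrite -[X in measurable X]setTI; exact: (mX t0).
Qed.

Lemma measurable_rational_survives t : 0 <= t -> measurable (rational_survives t).
Proof.
move=> t0.
rewrite (_ : rational_survives t = [set w | `]- b, a[%classic (X t w)] `&`
  (\bigcap_n \bigcap_(k in [set k | rat n k < t]) [set w | `]-oo, a]%classic (X (rat n k) w)]) `&`
  \bigcup_j (\bigcap_n \bigcap_(k in [set k | rat n k < t])
    [set w | `[- b + j.+1%:R^-1, +oo[%classic (X (rat n k) w)])).
  apply: measurableI; first apply: measurableI.
  - by apply: measurable_level => //; exact: measurable_itv.
  - apply: bigcapT_measurable => n; apply: bigcap_measurableType => k _.
    by apply: measurable_level => //; exact: measurable_itv.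
  - apply: bigcupT_measurable => j; apply: bigcapT_measurable => n.
    apply: bigcap_measurableType => k _.
    by apply: measurable_level => //; exact: measurable_itv.
apply/seteqP; split => w /=.
- move=> [h1 h2 h3 [j h4]]; split; first split.
  + by rewrite in_itv/= h1.
  + by move=> n _ k kt /=; rewrite in_itv/=; exact: h3.
  + by exists j => // n _ k kt /=; rewrite in_itv/= andbT; exact: h4.
- rewrite in_itv/= => -[[/andP[h1 h2] h3] [j _ h4]]; split => //.
  + by move=> n k kt; have := h3 n I k kt; rewrite /= in_itv.
  + by exists j => n k kt; have := h4 n I k kt; rewrite /= in_itv/= andbT.
Qed.

Lemma rational_survivesE t w : 0 <= t -> regular X g W w ->
  rational_survives t w <-> survives t w.
Proof.
move=> t0 rw; split.
- move=> [h1 h2 h3 [j h4]] s /andP[s0]; rewrite le_eqVlt => /predU1P[->|st].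
    by rewrite h1.
  have : 0 < j.+1%:R^-1 :> R by rewrite invr_gt0.
  move: (j.+1%:R^-1) h4 => z h4 z0.
  have [e1 e10 H1] := cadlag_right cadlagX w s0 z0.
  have [e2 e20 H2] := regular_right cadlagX W0 rw s0.
  pose e := Num.min (Num.min e1 e2) (t - s).
  have e0 : 0 < e by rewrite !lt_min e10 e20 subr_gt0.
  have m1 : e <= e1 by rewrite !ge_min lexx.
  have m2 : e <= e2 by rewrite !ge_min lexx orbT.
  have m3 : e <= t - s by rewrite !ge_min lexx !orbT.
  have [n [k]] := rational_right s0 e0; rewrite -/(rat n k).
  move: (h3 n k) (h4 n k); move: (rat n k) => r h3r h4r /andP[sr rs].
  have rt : r < t by lra.
  have := h3r rt; have := h4r rt.
  have /H1 : s <= r < s + e1 by apply/andP; split; lra.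
  rewrite ltr_norml => /andP[? ?] ? ?; apply/andP; split; first by lra.
  have := H2 s r (lexx _).
  have -> : s <= r < s + e2 by apply/andP; split; lra.
  have : 0 < g * (r - s) by rewrite mulr_gt0// subr_gt0.
  by move=> ? /(_ isT) ?; lra.
- move=> H.
  have Ht := H t; have /andP[h1 h2] := Ht (ltac:(by rewrite t0 lexx)).
  split => //.
    by move=> n k kt; have /andP[_ /ltW] := H (rat n k) (ltac:(by rewrite rat0 ltW)).
  (* Without a uniform margin, rational times with values down to [- b] cluster at some [s]. On the
     right of [s] this contradicts [- b < X s w]; on the left, the path increases from a value above
     [- b]. *)
  apply: contrapT => nj.
  have /choice[f Hf] j : exists nk : nat * nat, rat nk.1 nk.2 < t /\
      X (rat nk.1 nk.2) w < - b + j.+1%:R^-1.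
    apply: contrapT => K; apply: nj; exists j => n k kt.
    rewrite leNgt; apply/negP => Xk; apply: K; by exists (n, k).
  pose x j := rat (f j).1 (f j).2.
  have [|s /andP[s0 st] cs] := @cluster_seq R x 0 t.
    by move=> j; rewrite rat0 ltW//; case: (Hf j).
  have /andP[Xs _] := H s (ltac:(by rewrite s0)).
  have e0 : 0 < (X s w + b) / 2 by rewrite divr_gt0//; lra.
  have [e1 e10 H1] := cadlag_right cadlagX w s0 e0.
  have [J1 hJ1] := mesh_lt e0.
  have small j J : (J <= j)%N -> j.+1%:R^-1 <= J.+1%:R^-1 :> R.
    by move=> Jj; rewrite lef_pV2 ?posrE ?ltr0n// ler_nat.
  have right_absurd j : (J1 <= j)%N -> s <= x j < s + e1 -> False.
    move=> Jj /H1; rewrite ltr_norml => /andP[? ?].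
    have [_ Xj] := Hf j; move: (small _ _ Jj) Xj hJ1.
    by rewrite -/(x j); move: (j.+1%:R^-1) (J1.+1%:R^-1) => u v; lra.
  move: s0; rewrite le_eqVlt => /predU1P[s0|s0].
    have [j Jj] := cs _ J1 e10; rewrite -s0 subr0 ger0_norm ?rat0// => xj.
    by apply: (right_absurd j Jj); rewrite -s0 rat0 add0r.
  have [e2 /andP[e20 e2s] H2] := regular_left cadlagX W0 rw s0.
  pose r := s - e2 / 2.
  have r0 : 0 <= r <= t by rewrite /r; apply/andP; split; lra.
  have /andP[Xr _] := H r r0.
  have e30 : 0 < X r w + b by lra.
  have [J2 hJ2] := mesh_lt e30.
  have e40 : 0 < Num.min e1 (e2 / 2) by rewrite lt_min e10 divr_gt0.
  have m1 : Num.min e1 (e2 / 2) <= e1 by rewrite ge_min lexx.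
  have m2 : Num.min e1 (e2 / 2) <= e2 / 2 by rewrite ge_min lexx orbT.
  have [j Jj] := cs _ (maxn J1 J2) e40; rewrite ltr_norml => /andP[? ?].
  have [xs|sx] := ltP (x j) s; last first.
    apply: (right_absurd j); first exact: leq_trans (leq_maxl _ _) Jj.
    by apply/andP; split; lra.
  have := H2 r (x j); rewrite xs andbT.
  have -> : s - e2 < r by rewrite /r; lra.
  have rx : r <= x j by rewrite /r; lra.
  rewrite rx => /(_ isT isT).
  have : 0 <= g * (x j - r) by rewrite mulr_ge0 ?subr_ge0// ltW.
  have [_ Xj] := Hf j.
  move: (small _ _ (leq_trans (leq_maxr J1 J2) Jj)) hJ2 Xj.
  by rewrite -/(x j); move: (j.+1%:R^-1) (J2.+1%:R^-1) => u v; lra.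
Qed.

(** On the null set of irregular paths, [L] is an arbitrary subset, measurable by completeness. *)
Lemma measurable_modulo (L M : set T) : measurable M ->
  (forall w, regular X g W w -> L w <-> M w) -> measurable L.
Proof.
move=> mM LM.
have mN : measurable (~` [set w | regular X g W w]) by exact: complete.
have -> : L = (M `&` [set w | regular X g W w]) `|` (L `&` ~` [set w | regular X g W w]).
  apply/seteqP; split => w /=.
    by move=> Lw; have [rw|rw] := pselect (regular X g W w); [left; split => //; exact/LM|right].
  by move=> [[Mw rw]|[]//]; apply/LM.
apply: measurableU.
  by apply: measurableI => //; rewrite -[X in measurable X]setCK; exact: measurableC.
by apply: complete; apply: negligibleS reg; exact: subIsetr.
Qed.

Hypothesis ab : - b < 0 < a.

(* The exit side is read off the position at the end of the mesh cell in which
   the exit takes place. *)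
Lemma measurable_exit_side (c m : R) : c = 1 \/ c = -1 ->
  measurable [set w | [/\ (exit_time X a b w < +oo)%E,
    (a + b) / 2 <= c * (X (fine (exit_time X a b w)) w - (a - b) / 2) &
    m <= fine (exit_time X a b w)]].
Proof.
move=> c1; have /andP[b0 a0] := ab.
(* An exit at [m] or later amounts to survival up to [m - 1 / n.+1] for all [n]; negative times
   impose nothing. *)
pose late := \bigcap_n (if 0 <= m - n.+1%:R^-1 then rational_survives (m - n.+1%:R^-1) else setT).
(* At the exit, the distance to the centre [(a - b) / 2] is at least the half-width [(a + b) / 2].
   On a fine mesh the end of the exit cell is closer than that to the exit position, hence on the
   same side of the centre; [c] is the sign of that side. *)
pose side := \bigcup_p \bigcap_(n in [set n | (p <= n)%N]) \bigcup_k
  ((rational_survives (rat n k) `\` rational_survives (rat n k.+1)) `&`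
   [set w | [set x | 0 < c * (x - (a - b) / 2)] (X (rat n k.+1) w)]).
have mhalf : measurable [set x : R | 0 < c * (x - (a - b) / 2)].
  case: c1 => ->.
    rewrite (_ : [set _ | _] = `](a - b) / 2, +oo[%classic); first exact: measurable_itv.
    by apply/seteqP; split => x; rewrite /= in_itv/= andbT mul1r subr_gt0.
  rewrite (_ : [set _ | _] = `]-oo, (a - b) / 2[%classic); first exact: measurable_itv.
  by apply/seteqP; split => x; rewrite /= in_itv/= mulN1r oppr_gt0 subr_lt0.
apply: (@measurable_modulo _ (late `&` side)).
  apply: measurableI.
    apply: bigcapT_measurable => n; case: ifP => // m0.
    exact: measurable_rational_survives.
  apply: bigcupT_measurable => p; apply: bigcap_measurableType => n _.
  apply: bigcupT_measurable => k; apply: measurableI.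
    by apply: measurableD; exact: measurable_rational_survives.
  exact: measurable_level.
move=> w rw; have [X0 _ _] := rw.
have near_exit r n k : exit_time X a b w = r%:E ->
    rational_survives (rat n k) w -> ~ rational_survives (rat n k.+1) w ->
    r <= rat n k.+1 < r + n.+1%:R^-1.
  move=> E /(rational_survivesE (rat0 _ _) rw)/survives_exit; rewrite E lte_fin => kr.
  move=> /(iffLR (not_iff_compat (rational_survivesE (rat0 _ _) rw))) ns.
  rewrite {2}/rat -natr1 mulrDl mul1r -/(rat n k) ltrD2r kr andbT leNgt.
  by apply/negP => rk; apply: ns; apply: exit_survives; rewrite E lte_fin.
have lateE r : exit_time X a b w = r%:E -> late w <-> m <= r.
  move=> E; split.
    move=> H; rewrite leNgt; apply/negP => rm.
    have rm0 : 0 < m - r by rewrite subr_gt0.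
    have [n hn] := mesh_lt rm0.
    have := H n I.
    have r0 : 0 <= r.
      by have [[]|[r' r'0 []]] := exit_timeP w; rewrite E// => -[->].
    have -> : 0 <= m - n.+1%:R^-1 by move: hn; move: (n.+1%:R^-1) => z; lra.
    have mn : 0 <= m - n.+1%:R^-1 by move: hn; move: (n.+1%:R^-1) => z; lra.
    move=> /(rational_survivesE mn rw)/survives_exit; rewrite E lte_fin.
    by move: hn; move: (n.+1%:R^-1) => z; lra.
  move=> mr n _; case: ifP => // m0; apply/(rational_survivesE m0 rw).
  apply: exit_survives; rewrite E lte_fin (lt_le_trans _ mr)// ltrBlDr ltrDl.
  by rewrite invr_gt0.
have ab2 : 0 < (a + b) / 2 by rewrite divr_gt0//; lra.
split.
- move=> /= [Eoo + +].
  have [[E _]|[r r0 [E Xr _]]] := exit_timeP w; first by move: Eoo; rewrite E.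
  rewrite E /= => Xc mr; split; first exact/(lateE r E).
  have [e e0 H] := cadlag_right cadlagX w r0 ab2.
  have [p hp] := mesh_lt e0; exists p => // n /= pn.
  have rpos : 0 < r.
    rewrite lt_neqAle r0 andbT; apply/eqP => r00; apply: Xr.
    by rewrite -r00 X0 b0 a0.
  have [k /andP[kr rk]] := mesh_cell n rpos.
  exists k => //.
  have sk : rational_survives (rat n k) w.
    by apply/(rational_survivesE (rat0 _ _) rw); apply: exit_survives; rewrite E lte_fin.
  have nsk : ~ rational_survives (rat n k.+1) w.
    move=> /(rational_survivesE (rat0 _ _) rw)/survives_exit; rewrite E lte_fin.
    by rewrite /rat ltNge rk.
  split => //=.
  have /andP[h1 h2] := near_exit r n k E sk nsk.
  have np : n.+1%:R^-1 <= p.+1%:R^-1 :> R by rewrite lef_pV2 ?posrE ?ltr0n// ler_nat.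
  have /H : r <= rat n k.+1 < r + e.
    by rewrite h1 (lt_trans h2)// ltrD2l (le_lt_trans np).
  rewrite ltr_norml => /andP[? ?].
  by case: c1 Xc => ->; rewrite ?mul1r ?mulN1r; lra.
- move=> [lw [p _ H]].
  have [k0 _ [[sk0 nsk0] _]] := H p (leqnn p).
  have [[E K]|[r r0 [E Xr _]]] := exit_timeP w.
    by exfalso; apply: nsk0; apply/(rational_survivesE (rat0 _ _) rw); exact: K.
  rewrite /= E ltry /=; split => //; last exact/(lateE r E).
  have [e e0 K] := cadlag_right cadlagX w r0 ab2.
  have [q hq] := mesh_lt e0.
  have [k _ [[sk nsk] /= cX]] := H (maxn p q) (leq_maxl _ _).
  have /andP[h1 h2] := near_exit r _ k E sk nsk.
  have np : (maxn p q).+1%:R^-1 <= q.+1%:R^-1 :> R.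
    by rewrite lef_pV2 ?posrE ?ltr0n// ler_nat ltnS leq_maxr.
  have /K : r <= rat (maxn p q) k.+1 < r + e.
    by rewrite h1 (lt_trans h2)// ltrD2l (le_lt_trans np).
  rewrite ltr_norml => /andP[? ?].
  move/negP: Xr; rewrite negb_and -!leNgt => /orP[Xr|Xr];
    by case: c1 cX => ->; rewrite ?mul1r ?mulN1r; lra.
Qed.

Lemma measurable_plus_set m : measurable (plus_set m).
Proof.
rewrite (_ : plus_set m = [set w | [/\ (exit_time X a b w < +oo)%E,
    (a + b) / 2 <= 1 * (X (fine (exit_time X a b w)) w - (a - b) / 2) &
    m <= fine (exit_time X a b w)]]).
  by apply: measurable_exit_side; left.
by apply/seteqP; split => w [h1 + +]; rewrite /plus_set/= in_itv/= andbT => + h3;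
  move=> h2; split => //; clear h1 h3; move: h2; move: (X _ w) => x; lra.
Qed.

Lemma measurable_minus_set m : measurable (minus_set m).
Proof.
rewrite (_ : minus_set m = [set w | [/\ (exit_time X a b w < +oo)%E,
    (a + b) / 2 <= -1 * (X (fine (exit_time X a b w)) w - (a - b) / 2) &
    m <= fine (exit_time X a b w)]]).
  by apply: measurable_exit_side; right.
by apply/seteqP; split => w [h1 + +]; rewrite /minus_set/= in_itv/= andbT => + h3;
  move=> h2; split => //; clear h1 h3; move: h2; move: (X _ w) => x; lra.
Qed.

End exit.

(** * Chaining the moves, and the obstruction to late exits *)

Section reachability.
Context d (T : measurableType d) (R : realType) (P : probability T R).
Variables (X : R -> T -> R) (nu : {measure set R -> \bar R}).
Variables (a b g W : R).
Hypothesis mX : forall t, 0 <= t -> measurable_fun setT (X t).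
Hypothesis cadlagX : cadlag_paths X.
Hypothesis staX : stationary_increments P X.
Hypothesis indX : independent_increments P X.
Hypothesis hnu : is_levy_measure P X nu.
Hypothesis complete : P.-negligible `<=` measurable.
Hypothesis reg : P.-negligible (~` [set w | regular X g W w]).
Hypothesis g0 : 0 < g.
Hypothesis W0 : 0 < W.
Hypothesis edge : forall e, 0 < e ->
  (0 < nu `](- W - e)%R, (- W + e)%R[%classic)%E.
Hypotheses (a0 : 0 < a) (b0 : 0 < b).
Implicit Types (m n l u x v e t s : R) (w : T).

(* The accuracy e at x is arbitrary, so errors do not accumulate when moves are
   chained. *)
Definition reachable m n l u x : Prop := forall e, 0 < e ->
  exists t (C : set T), [/\ 0 <= t, n <= t, past P X t C, (0 < P C)%E &
    forall w, C w -> regular X g W w ->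
      [/\ survives X a b m w, (forall s, 0 <= s <= t -> l < X s w < u) &
          `|X t w - x| <= e]].

Lemma reachable_start : reachable 0 0 (- b) a 0.
Proof.
move=> e e0; exists 0, setT; split => //; first exact: pastT.
- by rewrite probability_setT lte01.
- move=> w _ [X0 _ _].
  have H s : 0 <= s <= 0 -> - b < X s w < a.
    by move=> /le_anti <-; rewrite X0 a0 oppr_lt0 b0.
  by split => //; rewrite X0 subrr normr0 ltW.
Qed.

(** The turn from surviving to exiting: the elapsed time [n] becomes guaranteed survival, and the
    band is widened so that later moves may leave ]-b, a[. *)
Lemma reachable_extend n l u x : l <= - b -> a <= u ->
  reachable 0 n (- b) a x -> reachable n n l u x.
Proof.
move=> lb au H e e0; have [t [C [t0 nt pC PC K]]] := H e e0.
exists t, C; split => // w Cw rw; have [K1 K2 K3] := K w Cw rw.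
split => // s /andP[s0 st]; first by apply: K2; rewrite s0 (le_trans st).
have /andP[? ?] := K2 s (ltac:(by rewrite s0)).
by apply/andP; split; lra.
Qed.

Lemma reachable_drift m n l u x v : 0 <= v -> l < x -> x + g * v < u ->
  reachable m n l u x -> reachable m (n + v) l u (x + g * v).
Proof.
rewrite le_eqVlt => /predU1P[<-|v0]; first by rewrite mulr0 !addr0.
move=> lx xu H e e0.
(* One third of [q] for the starting error and one for the tube keep the path strictly inside the
   band. *)
pose q := Num.min (Num.min e (x - l)) (u - (x + g * v)).
have q0 : 0 < q by rewrite !lt_min e0 !subr_gt0 lx.
have m1 : q <= e by rewrite !ge_min lexx.
have m2 : q <= x - l by rewrite !ge_min lexx orbT.
have m3 : q <= u - (x + g * v) by rewrite !ge_min lexx !orbT.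
have q30 : 0 < q / 3 by rewrite divr_gt0.
have [t [C [t0 nt pC PC K]]] := H _ q30.
have Pt := drift_tube_gt0 mX cadlagX staX indX reg v0 q30 t0.
have [pCt PCt] := tube_past mX cadlagX staX indX t0 t0 v0
  (right_closed_drift g (q / 3) v) pC.
exists (t + v), (C `&` tube X t v (drift_tube g (q / 3))); split => //.
- by rewrite addr_ge0// ltW.
- by rewrite lerD2r.
- by rewrite PCt mule_gt0.
move=> w [Cw tw] rw; have [K1 K2 K3] := K w Cw rw.
have K4 r : 0 <= r <= v -> `|X (t + r) w - x - g * r| <= 2 * (q / 3).
  move=> /tw; rewrite /drift_tube/= => tr; move: tr K3.
  move: (g * r) => z.
  by rewrite !ler_norml => /andP[? ?] /andP[? ?]; apply/andP; split; lra.
split => //.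
- move=> s /andP[s0 sv]; have [st|ts] := leP s t; first by apply: K2; rewrite s0.
  have rE : 0 <= s - t <= v by apply/andP; split; lra.
  have gv : g * (s - t) <= g * v by rewrite ler_pM2l//; lra.
  have gs : 0 <= g * (s - t) by rewrite mulr_ge0 ?ltW// subr_gt0.
  have := K4 _ rE; rewrite [t + _]addrC subrK; move: gv gs.
  move: (g * (s - t)) => z gv gs; rewrite ler_norml => /andP[? ?].
  by apply/andP; split; lra.
- have := K4 v; rewrite lexx (ltW v0) => /(_ isT).
  rewrite !ler_norml => /andP[? ?]; apply/andP; split; lra.
Qed.

(** The duration of the step depends on the accuracy asked for, whence only a lower bound on elapsed
    time in [reachable]. *)
Lemma reachable_down m n l u x : l < x - W -> x < u ->
  reachable m n l u x -> reachable m n l u (x - W).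
Proof.
move=> lx xu H e e0.
pose q := Num.min (Num.min e (x - W - l)) (u - x).
have q0 : 0 < q by rewrite !lt_min e0 !subr_gt0 lx.
have m1 : q <= e by rewrite !ge_min lexx.
have m2 : q <= x - W - l by rewrite !ge_min lexx orbT.
have m3 : q <= u - x by rewrite !ge_min lexx !orbT.
have q30 : 0 < q / 3 by rewrite divr_gt0.
have [h h0 Pt] := down_tube_gt0 mX cadlagX staX indX hnu W0 q30 (edge q30).
have [t [C [t0 nt pC PC K]]] := H _ q30.
have [pCt PCt] := tube_past mX cadlagX staX indX t0 t0 h0
  (right_closed_down W (q / 3) h) pC.
exists (t + h), (C `&` tube X t h (down_tube W (q / 3) h)); split => //.
- by rewrite addr_ge0// ltW.
- by rewrite (le_trans nt)// lerDl ltW.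
- by rewrite PCt mule_gt0// Pt.
move=> w [Cw tw] rw; have [K1 K2 K3] := K w Cw rw.
have end_ : `|X (t + h) w - (x - W)| <= 2 * (q / 3).
  have := tw h; rewrite lexx (ltW h0) => /(_ isT).
  rewrite /down_tube eqxx /= in_itv/=; move: K3.
  by rewrite !ler_norml => /andP[? ?] /andP[? ?]; apply/andP; split; lra.
split => //.
- move=> s /andP[s0 sv]; have [st|ts] := leP s t; first by apply: K2; rewrite s0.
  have rE : 0 <= s - t <= h by apply/andP; split; lra.
  have := tw _ rE; rewrite [t + _]addrC subrK /down_tube.
  have W0' := W0; move: K3; rewrite !ler_norml => /andP[? ?].
  by case: ifP => _; rewrite /= in_itv/= => /andP[? ?]; apply/andP; split; lra.
- by move: end_; rewrite !ler_norml => /andP[? ?]; apply/andP; split; lra.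
Qed.

Lemma reachable_downs m n l u x (k : nat) : l < x - W * k%:R -> x < u ->
  reachable m n l u x -> reachable m n l u (x - W * k%:R).
Proof.
move=> + xu H; elim: k => [|k IH]; first by rewrite mulr0 subr0.
rewrite -natr1 mulrDr mulr1 opprD addrA => lx.
have Wk : 0 <= W * k%:R by rewrite mulr_ge0// ltW.
have W0' := W0; apply: reachable_down => //; first by lra.
by apply: IH; lra.
Qed.

(* Climbing from c - W to c takes time W / g. *)
Lemma reachable_cycle c (k : nat) : 0 <= c < a -> - b < c - W ->
  reachable 0 (W / g * k%:R) (- b) a c.
Proof.
move=> /andP[c0 ca] bc; elim: k => [|k IH].
  have := @reachable_drift 0 0 (- b) a 0 (c / g).
  rewrite mulr0 [g * _]mulrC divfK ?gt_eqF// !add0r => H.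
  have : reachable 0 (c / g) (- b) a c.
    by apply: H; rewrite ?oppr_lt0 ?divr_ge0 ?(ltW g0)//; exact: reachable_start.
  move=> K e /K [t [C [t0 _ pC PC Kw]]]; by exists t, C; split.
have := @reachable_drift 0 (W / g * k%:R) (- b) a (c - W) (W / g).
rewrite [g * _]mulrC divfK ?gt_eqF// subrK.
rewrite -[k.+1%:R]natr1 [W / g * (_ + _)]mulrDr mulr1.
apply => //; first by rewrite divr_ge0// ltW.
exact: reachable_down.
Qed.

Lemma reachable_before m : 0 <= m -> m * g < a \/ W < a + b ->
  exists2 c, - b < c < a & reachable 0 m (- b) a c.
Proof.
move=> m0 [mg|Wab].
- exists (m * g).
    by rewrite mg andbT (@lt_le_trans _ _ 0) ?oppr_lt0// mulr_ge0// ltW.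
  have := @reachable_drift 0 0 (- b) a 0 m.
  rewrite !add0r [g * m]mulrC; apply => //; first by rewrite oppr_lt0.
  exact: reachable_start.
- have [a0' b0'] := (a0, b0); pose c := (Num.max 0 (W - b) + a) / 2.
  have m1 : 0 <= Num.max 0 (W - b) by rewrite le_max lexx.
  have m2 : W - b <= Num.max 0 (W - b) by rewrite le_max lexx orbT.
  have m3 : Num.max 0 (W - b) < a by rewrite gt_max a0; lra.
  exists c; first by rewrite /c; apply/andP; split; lra.
  pose k := (Num.truncn (m / (W / g))).+1.
  have Wg : 0 < W / g by rewrite divr_gt0.
  have mk : m <= W / g * k%:R.
    by rewrite mulrC -ler_pdivrMr// ltW// truncnS_gt.
  have c0 : 0 <= c < a by rewrite /c; apply/andP; split; lra.
  have bc : - b < c - W by rewrite /c; lra.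
  move=> e /(reachable_cycle k c0 bc)[t [C [t0 kt pC PC K]]].
  by exists t, C; split => //; exact: le_trans kt.
Qed.

Lemma prob_gt0_modulo (C L : set T) : measurable C -> measurable L ->
  (0 < P C)%E -> (forall w, C w -> regular X g W w -> L w) -> (0 < P L)%E.
Proof.
move=> mC mL PC CL; rewrite lt_neqAle measure_ge0 andbT eq_sym; apply/eqP => PL.
have : P.-negligible C.
  apply: (@negligibleS _ _ _ _ (L `|` ~` [set w | regular X g W w])).
    move=> w Cw; have [rw|rw] := pselect (regular X g W w); last by right.
    by left; exact: CL.
  by apply: negligibleU => //; exact/negligibleP.
by move=> /(measure_negligible mC) PC0; move: PC; rewrite PC0 ltxx.
Qed.

Let ab : - b < 0 < a. Proof. by rewrite oppr_lt0 b0. Qed.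

Lemma exit_plus_gt0 m c : - b < c < a -> reachable 0 m (- b) a c ->
  (0 < lambda_plus P X a b `[m, +oo[%classic)%E.
Proof.
move=> /andP[bc ca] H.
have K := reachable_extend (lexx _) (ltac:(by rewrite lerDl) : a <= a + 2) H.
(* Aiming at [a + 1] with accuracy [1 / 2] ends above [a], inside the band that reaches up to
   [a + 2]. *)
have [|||||t [C [t0 _ [mC _] PC Kw]]] :=
  @reachable_drift m m (- b) (a + 2) c ((a + 1 - c) / g) _ _ _ _ (1 / 2).
- by rewrite divr_ge0 ?(ltW g0)//; lra.
- by [].
- by rewrite [g * _]mulrC divfK ?gt_eqF//; lra.
- exact: K.
- by [].
have mp := measurable_plus_set cadlagX mX complete g0 W0 reg ab m.
apply: (prob_gt0_modulo mC mp PC) => w Cw rw.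
have [K1 K2 K3] := Kw w Cw rw.
apply: (exit_plus cadlagX t0 K1).
  move: K3; rewrite [g * _]mulrC divfK ?gt_eqF// ler_norml => /andP[? ?]; lra.
by move=> s /K2/andP[].
Qed.

Lemma exit_minus_gt0 m c : - b < c < a -> reachable 0 m (- b) a c ->
  (0 < lambda_minus P X a b `[m, +oo[%classic)%E.
Proof.
move=> /andP[bc ca] H.
(* Enough steps to bring [c] strictly below [- b]; the remaining gap is the accuracy used. *)
pose k := (Num.truncn ((c + b) / W)).+1.
have kW : c - W * k%:R < - b.
  have : (c + b) / W < k%:R by exact: truncnS_gt.
  by rewrite ltr_pdivrMr// mulrC; lra.
pose l := c - W * k%:R - 1.
have lb : l <= - b by rewrite /l; lra.
have K := reachable_extend lb (lexx a) H.
have e0 : 0 < - b - (c - W * k%:R) by rewrite subr_gt0.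
have [|||t [C [t0 _ [mC _] PC Kw]]] := @reachable_downs m m l a c k _ _ _ _ e0.
- by rewrite /l; lra.
- by [].
- exact: K.
have mp := measurable_minus_set cadlagX mX complete g0 W0 reg ab m.
apply: (prob_gt0_modulo mC mp PC) => w Cw rw.
have [K1 K2 K3] := Kw w Cw rw.
apply: (exit_minus cadlagX t0 K1).
  by move: K3; rewrite ler_norml => /andP[? ?]; lra.
by move=> s /K2/andP[].
Qed.

(* Since a + b <= W, the first negative jump is an exit; before it the path lies
   above the drift, so that an exit from below at a time T >= m >= a / g forces
   T = m = a / g to be a jump time. *)
Lemma exit_minus_jump m w : a <= m * g -> a + b <= W -> regular X g W w ->
  minus_set X a b m w -> jump X w m <= - W.
Proof.
move=> amg abW rw.
have m0 : 0 < m by rewrite -(pmulr_lgt0 m g0) (lt_le_trans a0).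
have [[E _]|[r r0 [E _ S]]] := exit_timeP a b cadlagX w.
  by rewrite /minus_set/= E => -[].
rewrite /minus_set/= E /= => -[_ Xr]; rewrite in_itv/= andbT => mr.
have inside s : 0 <= s < r -> - b < X s w < a.
  by move=> /andP[s0 /S]; apply; rewrite s0 lexx.
(* The path is below [a] just before [s]: a negative jump, of size at least [W >= a + b], would give
   [X s w <= - b]. *)
have nojump s : 0 < s < r -> 0 <= jump X w s.
  move=> /andP[s0 sr]; rewrite leNgt; apply/negP => js.
  have [_ _ /(_ s s0 js) jW] := rw.
  have /andP[Xs _] : - b < X s w < a by apply: inside; rewrite (ltW s0).
  have e0 : 0 < X s w + b by lra.
  have [e e0' H] := jump_increment cadlagX w s0 e0.
  have q0 : 0 < Num.min e s by rewrite lt_min e0'.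
  have q1 : Num.min e s <= e by rewrite ge_min lexx.
  have q2 : Num.min e s <= s by rewrite ge_min lexx orbT.
  have /andP[_ Xq] : - b < X (s - Num.min e s / 2) w < a.
    by apply: inside; apply/andP; split; lra.
  have := H (s - Num.min e s / 2) s.
  have -> : s - e < s - Num.min e s / 2 < s by apply/andP; split; lra.
  rewrite lexx ltrDl e0' => /(_ isT isT); rewrite ltr_norml => /andP[? ?]; lra.
have above s : 0 <= s < r -> g * s <= X s w.
  move=> /andP[s0 sr]; have [X0 _ _] := rw.
  have := @regular_growth _ _ _ X g W w 0 s rw; rewrite lexx s0 X0 !subr0; apply => //.
  by move=> v /andP[v0 vs]; apply: nojump; rewrite v0 (le_lt_trans vs).
have mE : m = r.
  apply/eqP; rewrite eq_le mr/= leNgt; apply/negP => mr'.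
  have mI : 0 <= m < r by rewrite (ltW m0).
  have := above m mI; have /andP[_] := inside m mI.
  by rewrite mulrC; lra.
rewrite -mE in Xr inside above.
(* It remains to see that the jump at [m] is negative: just before [m] the path is above the drift,
   hence nonnegative, and [X m w <= - b]; accuracy [b] suffices. *)
have [_ _ /(_ m m0) ->//] := rw.
have [e e0' H] := jump_increment cadlagX w m0 b0.
have q0 : 0 < Num.min e m by rewrite lt_min e0'.
have q1 : Num.min e m <= e by rewrite ge_min lexx.
have q2 : Num.min e m <= m by rewrite ge_min lexx orbT.
have mI : 0 <= m - Num.min e m / 2 < m by apply/andP; split; lra.
have := above _ mI.
have : 0 <= g * (m - Num.min e m / 2) by rewrite mulr_ge0 ?(ltW g0)//; case/andP: mI.
have := H (m - Num.min e m / 2) m.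
have -> : m - e < m - Num.min e m / 2 < m by apply/andP; split; lra.
rewrite lexx ltrDl e0' => /(_ isT isT); rewrite ltr_norml => /andP[? ?] ? ?; lra.
Qed.

Lemma exit_minus_null m : a <= m * g -> a + b <= W ->
  lambda_minus P X a b `[m, +oo[%classic = 0%E.
Proof.
move=> amg abW.
have m0 : 0 < m by rewrite -(pmulr_lgt0 m g0) (lt_le_trans a0).
have N : P.-negligible (minus_set X a b m).
  apply: (@negligibleS _ _ _ _ ([set w | jump X w m <= - W] `|`
      ~` [set w | regular X g W w])).
    move=> w Lw; have [rw|rw] := pselect (regular X g W w); last by right.
    by left; exact: exit_minus_jump.
  apply: negligibleU => //.
  exact: (fixed_jump_negligible mX cadlagX staX).
by apply: measure_negligible => //; exact: complete.
Qed.

End reachability.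

Theorem proposition8 (R : realType) (d : measure_display) (T : measurableType d)
    (P : probability T R) (F : R -> set (set T)) (X : R -> T -> R)
    (sigma2 gamma0 : R) (nu : {measure set R -> \bar R}) (W m a b : R)
    (hF : usual_conditions P F)
    (hX : levy_process P F X)
    (hnu : is_levy_measure P X nu)
    (hfv : (\int[nu]_x (Num.min 1 `|x|)%:E < +oo)%E)
    (hdd : diffusion_and_drift P F X sigma2 gamma0)
    (hsigma : sigma2 = 0)
    (hgamma : 0 < gamma0)
    (hsupp : ~ measure_support (restr_npos nu) 0)
    (hneg : nu `]-oo, (0 : R)[%classic != 0%E)
    (hW : W = - sup (measure_support (restr_npos nu)))
    (hm : 0 <= m) (ha : 0 < a) (hb : 0 < b) :
  ((0 < lambda_plus P X a b `[m, +oo[%classic)%E /\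
   (0 < lambda_minus P X a b `[m, +oo[%classic)%E)
  <-> (m * gamma0 < a \/ W < a + b).
Proof.
have [filtF _ nullF] := hF.
have complete : P.-negligible `<=` measurable.
  move=> A /nullF FA; have [_ FT _] := filtF; exact: (FT 0 (lexx _)).
have [aX cX _ sX iX] := hX.
have mX t : 0 <= t -> measurable_fun setT (X t) by exact: (measurable_adapted filtF aX).
have W0 : 0 < W by rewrite hW; exact: gap_gt0.
have edge e : 0 < e -> (0 < nu `](- W - e)%R, (- W + e)%R[%classic)%E.
  by move=> e0; rewrite hW opprK; exact: gap_edge.
rewrite hsigma in hdd.
have reg : P.-negligible (~` [set w | regular X gamma0 W w]).
  by apply: (regular_ae filtF hX hnu hdd); rewrite hW opprK; exact: gap_null.
split=> [[_ lm]|].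
(* When both inequalities fail, it is [lambda_minus] that vanishes. *)
- apply: contrapT => /not_orP[/negP + /negP]; rewrite -!leNgt => amg abW.
  by move: lm; rewrite (exit_minus_null mX cX sX complete reg hgamma W0 ha hb amg abW) ltxx.
- move=> /(reachable_before mX cX sX iX hnu reg hgamma W0 edge ha hb hm)[c bca H].
  split.
  + exact: (exit_plus_gt0 mX cX sX iX complete reg hgamma W0 ha hb bca H).
  + exact: (exit_minus_gt0 mX cX sX iX hnu complete reg hgamma W0 edge ha hb bca H).
Qed.
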